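(* Let $\mathbb Q$ be a probability measure equivalent to $\mathbb P$ and assume that, under $\mathbb Q$, the process $\{\mathbf X(t)\}_{t\ge 0}$ is a polynomial process in $\mathbb R^n$. Then $\mathbf X$ is $\mathbb Q$-integrable (i.e. $\mathbf X(t)$ is $\mathbb Q$-integrable for all $t$) and $\mathbb Q$-affine, with the functions $(t,T)\mapsto\mathbf a(t,T)$ and $(t,T)\mapsto\mathcal A(t,T)$ being homogeneous: there are functions $\mathcal A:\mathbb R_+\to\mathbb R^{n\times n}$ and $\mathbf a:\mathbb R_+\to\mathbb R^n$ such that $$\mathbb E_{\mathbb Q}[\mathbf X(T)\,|\,\mathcal F_t]=\mathcal A(T-t)\mathbf X(t)+\mathbf a(T-t),\qquad 0\le t\le T<\infty .$$
   Context: The setting is a filtered probability space $(\Omega,\mathcal F,\{\mathcal F_t\}_{t\ge 0},\mathbb P)$ satisfying the usual conditions. A process $\mathbf X$ in $\mathbb R^n$ is called $\mathbb Q$-affine if there exist measurable deterministic functions $(t,T)\mapsto\mathcal A(t,T)\in\mathbb R^{n\times n}$ and $(t,T)\mapsto\mathbf a(t,T)\in\mathbb R^n$ such that $\mathbb E_{\mathbb Q}[\mathbf X(T)\,|\,\mathcal F_t]=\mathcal A(t,T)\mathbf X(t)+\mathbf a(t,T)$ for $0\le t\le T<\infty$. Polynomial process (in the sense of Cuchiero, Keller-Ressel and Teichmann, and Filipović and Larsson): a càdlàg $\mathbb Q$-semimartingale $\mathbf X$ with values in $\mathbb R^n$ and deterministic initial state, which is a time-homogeneous Markov process with respect to $\{\mathcal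 F_t\}$, whose (extended) generator $\mathcal G$ is defined on all polynomials on $\mathbb R^n$ and preserves degree, i.e. for every $k\in\mathbb N_0$, $\mathcal G$ maps the space of polynomials of degree at most $k$ into itself; and for every polynomial $p$, the process $p(\mathbf X(t))-p(\mathbf X(0))-\int_0^t\mathcal G p(\mathbf X(s))\,ds$ is a $\mathbb Q$-local martingale. *)

(* Defs.v *)
From HB Require Import structures.
From mathcomp Require Import all_boot all_order all_algebra.
From mathcomp Require Import all_classical all_reals all_analysis.
(* Not imported: its notations clash with those of MathComp-Analysis. *)
From mathcomp Require mpoly.

Set Implicit Arguments.
Unset Strict Implicit.
Unset Printing Implicit Defensive.

Import Order.TTheory GRing.Theory Num.Theory.
Import numFieldTopology.Exports numFieldNormedType.Exports.

Local Open Scope classical_set_scope.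
Local Open Scope ring_scope.

(* Time is the half-line [0, +oo[ of R: processes and filtrations are functions
   on R of which only the values at nonnegative times are ever constrained. *)

Section filtrations.
Context d (Omega : measurableType d) (R : realType).
Implicit Types (F : R -> set (set Omega)) (P Q : probability Omega R).

Definition filtration F : Prop :=
  [/\ forall t, 0 <= t -> sigma_algebra [set: Omega] (F t),
      forall t, 0 <= t -> F t `<=` measurable &
      forall s t, 0 <= s -> s <= t -> F s `<=` F t].

(* [P.-negligible N] does not presuppose that N is measurable, so the second
   clause also says that the probability space is complete. *)
Definition usual_conditions P F : Prop :=
  (forall t, 0 <= t -> \bigcap_(u in [set u | t < u]) F u = F t) /\
  (forall N, P.-negligible N -> F 0 N).

Definition equivalent_measures P Q : Prop := P `<< Q /\ Q `<< P.

Definition measurable_wrt d' (U : measurableType d')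
    (G : set (set Omega)) (Y : Omega -> U) : Prop :=
  measurable_fun [set: g_sigma_algebraType G] (Y : g_sigma_algebraType G -> U).

Definition adapted F d' (U : measurableType d') (Y : R -> Omega -> U) : Prop :=
  forall t, 0 <= t -> measurable_wrt (F t) (Y t).

(* Y is a version of E_Q[Z | G]. *)
Definition is_cond_exp Q (G : set (set Omega)) (Z Y : Omega -> R) : Prop :=
  [/\ Q.-integrable [set: Omega] (EFin \o Z),
      Q.-integrable [set: Omega] (EFin \o Y),
      measurable_wrt G Y &
      forall A, G A ->
        (\int[Q]_(w in A) (Y w)%:E = \int[Q]_(w in A) (Z w)%:E)%E].

Definition cadlag_path (V : topologicalType) (f : R -> V) : Prop :=
  (forall t, 0 <= t -> f s @[s --> t^'+] --> f t) /\
  (forall t, 0 < t -> exists l : V, f s @[s --> t^'-] --> l).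

Definition cadlag (V : topologicalType) (Y : R -> Omega -> V) : Prop :=
  forall w, cadlag_path (Y ^~ w).

Definition martingale Q F (M : R -> Omega -> R) : Prop :=
  [/\ cadlag M, adapted F M,
      forall t, 0 <= t -> Q.-integrable [set: Omega] (EFin \o M t) &
      forall s t, 0 <= s -> s <= t -> is_cond_exp Q (F s) (M t) (M s)].

Definition stopping_time F (tau : Omega -> \bar R) : Prop :=
  (forall w, (0 <= tau w)%E) /\
  (forall t, 0 <= t -> F t [set w | (tau w <= t%:E)%E]).

Definition stopped (M : R -> Omega -> R) (tau : Omega -> \bar R)
    : R -> Omega -> R :=
  fun t w => M (fine (Order.min t%:E (tau w))) w.

Definition local_martingale Q F (M : R -> Omega -> R) : Prop :=
  [/\ cadlag M, adapted F M &
      exists tau : nat -> Omega -> \bar R,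
        [/\ forall k, stopping_time F (tau k),
            {ae Q, forall w,
               (forall k, (tau k w <= tau k.+1 w)%E) /\
               tau k w @[k --> \oo] --> +oo%E} &
            forall k,
              martingale Q F (fun t w => stopped M (tau k) t w - M 0 w)]].

Definition semimartingale Q F (Y : R -> Omega -> R) : Prop :=
  exists M A : R -> Omega -> R,
    [/\ local_martingale Q F M /\ (forall w, M 0 w = 0),
        cadlag A /\ adapted F A,
        forall w, A 0 w = 0,
        forall w t, 0 <= t -> bounded_variation 0 t (A ^~ w) &
        forall w t, 0 <= t -> Y t w = Y 0 w + M t w + A t w].

End filtrations.

(* R^n as a column space with its Borel sigma-algebra. *)
Definition borelV (R : realType) (n : nat) :=
  g_sigma_algebraType (@open 'cV[R]_n).

Section polynomial_processes.
Context d (Omega : measurableType d) (R : realType) (n : nat).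
Implicit Types (F : R -> set (set Omega)) (Q : probability Omega R).
Implicit Types (X : R -> Omega -> 'cV[R]_n).

Definition poly_fun (p : mpoly.mpoly n R) : 'cV[R]_n -> R :=
  fun x => mpoly.meval (fun i => x i 0) p.

(* The polynomial functions of total degree at most k. *)
Definition Pol (k : nat) : set ('cV[R]_n -> R) :=
  [set f | exists p : mpoly.mpoly n R,
     all (fun m => mpoly.mdeg m <= k)%N (mpoly.msupp p) /\ f = poly_fun p].

Definition homogeneous_markov Q F X : Prop :=
  adapted F (X : R -> Omega -> borelV R n) /\
  exists p : R -> R.-pker borelV R n ~> borelV R n,
    forall t h, 0 <= t -> 0 <= h ->
    forall B : set (borelV R n), measurable B ->
      is_cond_exp Q (F t) (\1_B \o X (t + h)) (fun w => fine (p h (X t w) B)).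

Record extended_generator Q F X
    (D : set ('cV[R]_n -> R)) (G : ('cV[R]_n -> R) -> ('cV[R]_n -> R))
    : Prop := {
  generator_linear : forall (a : R) f g, D f -> D g ->
    D (fun x => a * f x + g x) /\
    G (fun x => a * f x + g x) = (fun x => a * G f x + G g x);
  generator_measurable : forall f, D f ->
    measurable_fun [set: borelV R n] (f : borelV R n -> R) /\
    measurable_fun [set: borelV R n] (G f : borelV R n -> R);
  generator_integrable : forall f, D f -> forall w t, 0 <= t ->
    (@lebesgue_measure R).-integrable `[0, t] (fun s => (G f (X s w))%:E);
  generator_martingale : forall f, D f ->
    local_martingale Q F (fun t w =>
      f (X t w) - f (X 0 w)
      - \int[@lebesgue_measure R]_(s in `[0, t]) G f (X s w)) }.

Definition polynomial_process Q F X : Prop :=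
  [/\ cadlag X /\ (forall i : 'I_n, semimartingale Q F (fun t w => X t w i 0)),
      exists x0, forall w, X 0 w = x0,
      homogeneous_markov Q F X &
      exists D G, [/\ extended_generator Q F X D G,
        forall k, Pol k `<=` D &
        forall k f, Pol k f -> Pol k (G f)]].

Definition integrable_process Q X : Prop :=
  forall t, 0 <= t -> forall i : 'I_n,
    Q.-integrable [set: Omega] (fun w => (X t w i 0)%:E).

(* The coefficients are functions on the set of pairs (t, T) with
   0 <= t <= T. *)
Definition affine_with Q F X
    (A : R -> R -> 'M[R]_n) (a : R -> R -> 'cV[R]_n) : Prop :=
  let domain := [set u : R * R | 0 <= u.1 <= u.2] in
  [/\ forall i j, measurable_fun domain (fun u => A u.1 u.2 i j),
      forall i, measurable_fun domain (fun u => a u.1 u.2 i 0) &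
      forall t T, 0 <= t -> t <= T -> forall i : 'I_n,
        is_cond_exp Q (F t) (fun w => X T w i 0)
          (fun w => (A t T *m X t w + a t T) i 0)].

Definition affine_process Q F X : Prop :=
  exists A a, affine_with Q F X A a.

End polynomial_processes.

(* Main.v *)
Require Import Defs.
From mathcomp Require Import all_boot all_order all_algebra.
From mathcomp Require Import all_classical all_reals all_analysis.
From mathcomp Require Import measurable_realfun ring lra.
From mathcomp Require mpoly.

Set Implicit Arguments.
Unset Strict Implicit.
Unset Printing Implicit Defensive.

Import Order.TTheory GRing.Theory Num.Theory.
Import numFieldTopology.Exports numFieldNormedType.Exports.

Local Open Scope classical_set_scope.
Local Open Scope ring_scope.

(** Let G be the generator, |x| the Euclidean norm and q(x) = 1 + |x|^2.  As q
    has degree two, G q has degree at most two, and G q <= C q for some C > 0.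
    By Gronwall's argument in exponential form, exp(-C t) q(X_t) is then a
    nonnegative supermartingale ([exp_supermartingale]): the argument takes
    expectations of localized martingales only, since q(X_t) is not known to be
    integrable beforehand.

    Doob's maximal inequality gives a weak-type bound on the supremum of
    |X_s|^2 over [0, T], hence an integrable bound on the supremum of |X_s|
    itself ([square_dominated]).  A local martingale dominated on [0, T] by an
    integrable variable satisfies the martingale identity on [0, T], whatever
    its localizing sequence ([dominated_local_martingale]).  This matters since
    each polynomial comes with a localizing sequence of its own, and going
    through the supremum avoids combining stopping times.

    Put Z = (1, X).  The generator maps affine functions to affine functions, so
    there is a matrix B such that Z_t - Z_0 - int_0^t B Z_s ds is a local
    martingale, and Z is dominated by what precedes.  For A in F_t and u >= t,
    the vector m(u) = E[Z_u ; A] therefore solves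
    m(u) = m(t) + int_t^u B m(v) dv, whence m(T) = exp((T - t) B) m(t)
    ([integral_taylor], [linear_drift_expmx]).  As A is arbitrary,
    E[Z_T | F_t] = exp((T - t) B) Z_t ([linear_drift_cond_exp]); the rows of
    exp((T - t) B) other than the first one carry the two coefficients of the
    theorem, which depend on T - t alone. *)

(** * Integrals of real functions *)

Section integrable_real.
Context d (T : measurableType d) (R : realType).
Variables (nu : {measure set T -> \bar R}) (D : set T).
Hypothesis mD : measurable D.
Implicit Types f g : T -> R.

Lemma integrable_EFinM k f : nu.-integrable D (EFin \o f) ->
  nu.-integrable D (EFin \o (fun x => k * f x)).
Proof. by move=> fi; apply: eq_integrable (integrableZl mD k fi). Qed.

Lemma integrable_EFinD f g : nu.-integrable D (EFin \o f) ->
  nu.-integrable D (EFin \o g) ->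
  nu.-integrable D (EFin \o (fun x => f x + g x)).
Proof. by move=> fi gi; apply: eq_integrable (integrableD mD fi gi). Qed.

Lemma integrable_EFinB f g : nu.-integrable D (EFin \o f) ->
  nu.-integrable D (EFin \o g) ->
  nu.-integrable D (EFin \o (fun x => f x - g x)).
Proof. by move=> fi gi; apply: eq_integrable (integrableB mD fi gi). Qed.

Lemma integrable_lincomb (I : finType) (b : I -> R) (g : I -> T -> R) :
  (forall i, nu.-integrable D (EFin \o g i)) ->
  nu.-integrable D (EFin \o (fun x => \sum_i b i * g i x)).
Proof.
move=> ig; apply: (@eq_integrable _ _ _ _ _ mD (fun x => (\sum_i (b i * g i x)%:E)%E)).
  by move=> x _; rewrite /= sumEFin.
by apply: integrable_sum => // i _; exact: integrable_EFinM.
Qed.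

Lemma Rintegral_lincomb (I : finType) (b : I -> R) (g : I -> T -> R) :
  (forall i, nu.-integrable D (EFin \o g i)) ->
  \int[nu]_(x in D) (\sum_i b i * g i x) = \sum_i b i * \int[nu]_(x in D) g i x.
Proof.
move=> ig; rewrite /Rintegral.
under eq_integral do rewrite -sumEFin.
rewrite integral_sum//; last by move=> i; exact: integrable_EFinM.
rewrite -sum_fine//; last first.
  by move=> i _; apply: integrable_fin_num => //; exact: integrable_EFinM.
by apply: eq_bigr => i _; exact: RintegralZl.
Qed.

End integrable_real.

(** * Paths on the time axis *)

Section real_line.
Context {R : realType}.
Notation mu := (@lebesgue_measure R).
Implicit Types (f g y z m : R -> R) (a b s t T : R).

(** A cadlag path need not be continuous, but it is locally bounded, and local
    boundedness is all that compactness of [0, T] uses. *)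
Lemma cadlag_bounded f T :
  cadlag_path f -> exists K, forall u, 0 <= u <= T -> `|f u| <= K.
Proof.
move=> [fr fl].
have /compact_near_coveringP cov := @segment_compact R 0 T.
have H : \forall K \near +oo, `[0, T] `<=` (fun u => 0 <= u -> `|f u| <= K).
  apply: (cov R +oo (fun K u => 0 <= u -> `|f u| <= K)).
  move=> u /=; rewrite in_itv/= => /andP[u0 uT].
  (* The one-sided limits at u bound f on either side of u. *)
  have bnd (G : set_system R) (FG : ProperFilter G) (l : R) :
      f v @[v --> G] --> l -> \forall v \near G, `|f v| <= `|l| + 1.
    move=> /cvgrPdist_le /(_ 1 ltr01); apply: filterS => v /= lv.
    rewrite -lerBlDl (le_trans _ lv)// (le_trans (lerB_dist _ _))//.
    by rewrite distrC.
  have [K HK] : exists K, \forall v \near u, 0 <= v -> `|f v| <= K.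
    have Hr := bnd _ (at_right_proper_filter u) _ (fr _ u0).
    have [u_gt0|] := ltP 0 u.
      have [l /(bnd _ (at_left_proper_filter u)) Hl] := fl _ u_gt0.
      exists (Num.max `|f u| (Num.max (`|f u| + 1) (`|l| + 1))).
      move: Hl Hr; rewrite !near_withinE => Hl Hr.
      apply: filterS2 Hl Hr => v Hl Hr v0; rewrite !le_max.
      have [vu|uv|->] := ltgtP v u; last by rewrite lexx.
      - by rewrite Hl ?orbT.
      - by rewrite Hr ?orbT.
    move=> u_le0; have {u_le0 u0} u0 : u = 0 by apply/le_anti; rewrite u_le0 u0.
    exists (Num.max `|f u| (`|f u| + 1)).
    move: Hr; rewrite !near_withinE => Hr.
    apply: filterS Hr => v Hr v0; rewrite !le_max.
    have [vu|uv|->] := ltgtP v u; last by rewrite lexx.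
      by move: vu; rewrite u0 ltNge v0.
    by rewrite Hr ?orbT.
  exists ([set v | 0 <= v -> `|f v| <= K], [set M | K <= M]) => /=.
    by split => //; exact: nbhs_pinfty_ge (num_real K).
  by move=> [v M] /= [vK KM] v0; exact: le_trans (vK v0) KM.
have [K HK] : exists K, `[0, T] `<=` (fun u => 0 <= u -> `|f u| <= K).
  exact: (@filter_ex _ +oo).
by exists K => u uT; apply: HK; [rewrite /= in_itv|case/andP: uT].
Qed.

Lemma Rintegral_derive (F f : R -> R) a b : a <= b ->
  (forall x : R, is_derive x (1 : R) F (f x)) -> continuous f ->
  \int[mu]_(x in `[a, b]) f x = F b - F a.
Proof.
rewrite le_eqVlt => /predU1P[<- _ _|ab dF cf].
  by rewrite set_itv1 Rintegral_set1 subrr.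
rewrite /Rintegral (@continuous_FTC2 R f F a b ab).
- by rewrite -EFinB.
- exact: continuous_subspaceT.
- have cF : continuous F.
    by move=> x; apply/differentiable_continuous/derivable1_diffP; case: (dF x).
  split.
  + by move=> x _; case: (dF x).
  + by apply: cvg_at_right_filter; exact: cF.
  + by apply: cvg_at_left_filter; exact: cF.
- by move=> x _; rewrite derive1E; apply: derive_val.
Qed.

Lemma continuous_expRN C : continuous (fun u : R => expR (- (C * u))).
Proof.
move=> u; apply: (@continuous_comp _ _ _ (fun u => - (C * u)) expR).
  by apply: cvgN; apply: cvgM; [exact: cvg_cst|exact: cvg_id].
exact: continuous_expR.
Qed.

Lemma cadlag_path_expRN C f : cadlag_path f ->
  cadlag_path (fun u => expR (- (C * u)) * f u).
Proof.
move=> [fr fl]; split=> u u0.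
  apply: cvgM; last exact: fr.
  exact: cvg_at_right_filter (@continuous_expRN C u).
have [l ul] := fl u u0; exists (expR (- (C * u)) * l).
by apply: cvgM => //; exact: cvg_at_left_filter (@continuous_expRN C u).
Qed.

Lemma Rintegral_expRN C a b : a <= b ->
  C * \int[mu]_(u in `[a, b]) expR (- (C * u)) = expR (- (C * a)) - expR (- (C * b)).
Proof.
move=> ab.
have cE := @continuous_expRN C.
rewrite -RintegralZl//; last first.
  apply: continuous_compact_integrable; first exact: segment_compact.
  exact: continuous_subspaceT.
rewrite [RHS](_ : _ = - expR (- (C * b)) - - expR (- (C * a))); last by ring.
apply: (@Rintegral_derive (fun u => - expR (- (C * u)))) => //.
- move=> x; apply: is_derive_eq.
  by rewrite /GRing.scale/=; ring.
- by move=> x; apply: cvgM; [exact: cvg_cst|exact: cE].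
Qed.

Lemma Rintegral_power (a b : R) n : a <= b ->
  \int[mu]_(u in `[a, b]) ((u - a) ^+ n / n`!%:R) = (b - a) ^+ n.+1 / n.+1`!%:R.
Proof.
move=> ab.
rewrite [RHS](_ : _ = (b - a) ^+ n.+1 / n.+1`!%:R - (a - a) ^+ n.+1 / n.+1`!%:R); last first.
  by rewrite subrr expr0n/= mul0r subr0.
apply: (@Rintegral_derive (fun u => (u - a) ^+ n.+1 / n.+1`!%:R)) => //.
- move=> x.
  have -> : (fun u => (u - a) ^+ n.+1 / n.+1`!%:R)
      = (n.+1`!%:R)^-1 *: (fun u => u - a) ^+ n.+1.
    by apply/funext => u; rewrite !fctE /GRing.scale/= mulrC.
  apply: is_derive_eq.
  rewrite subr0 factS natrM /GRing.scale/= mulr1.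
  have f0 : n`!%:R != 0 :> R by rewrite pnatr_eq0 -lt0n fact_gt0.
  by field; rewrite f0 addrC natr1 pnatr_eq0.
- move=> x; apply: cvgM; last exact: cvg_cst.
  have ca : {for x, continuous (fun u : R => u - a)}.
    by apply: cvgB; [exact: cvg_id|exact: cvg_cst].
  exact: (continuous_comp ca (@exprn_continuous _ n _)).
Qed.

(** Fubini's theorem on the triangle {a <= v <= u <= b}.  It stands in for an
    integration by parts, as the integrands below are not continuous. *)
Lemma Rintegral_triangle f g a b :
  mu.-integrable `[a, b] (EFin \o f) -> mu.-integrable `[a, b] (EFin \o g) ->
  \int[mu]_(u in `[a, b]) (f u * \int[mu]_(v in `[a, u]) g v) =
  \int[mu]_(v in `[a, b]) (g v * \int[mu]_(u in `[v, b]) f u).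
Proof.
move=> fi gi.
pose f' := f \_ `[a, b]; pose g' := g \_ `[a, b].
have mf' : measurable_fun setT f'.
  apply/(measurable_restrictT _ _).1 => //.
  by apply/measurable_EFinP; exact: measurable_int fi.
have mg' : measurable_fun setT g'.
  apply/(measurable_restrictT _ _).1 => //.
  by apply/measurable_EFinP; exact: measurable_int gi.
have fi' : mu.-integrable setT (EFin \o f').
  by rewrite -restrict_EFin -integrable_mkcond.
have gi' : mu.-integrable setT (EFin \o g').
  by rewrite -restrict_EFin -integrable_mkcond.
pose D := [set p : R * R | p.2 <= p.1].
have mD : measurable D.
  by rewrite -[D]setTI; apply: measurable_fun_le.
pose h (p : R * R) := f' p.1 * g' p.2 * \1_D p.
have mh : measurable_fun setT h.
  apply: measurable_funM; last exact: measurable_indic.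
  by apply: measurable_funM; apply: measurableT_comp.
have ih : (mu \x mu)%E.-integrable setT (EFin \o h).
  apply/integrable12ltyP; first exact/measurable_EFinP.
  have [K KE] : exists K : R, (\int[mu]_v `|(g' v)%:E| = K%:E)%E.
    move/integrableP : gi' => [_]; rewrite -ge0_fin_numE ?integral_ge0//.
    by move/fineK => <-; eexists.
  have mabs (k : R -> R) : measurable_fun setT k ->
      measurable_fun setT (fun u => `|k u|) by exact: measurableT_comp.
  apply: (@le_lt_trans _ _ (\int[mu]_u (`|f' u| * K)%:E)%E).
    apply: ge0_le_integral => //.
    - by move=> u _; exact: integral_ge0.
    - have mah : measurable_fun setT (abse \o (EFin \o h)).
        by apply/measurableT_comp => //; exact/measurable_EFinP.
      exact: (@measurable_fun_fubini_tonelli_F _ _ _ _ R mu _ mah (fun p => abse_ge0 _)).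
    - by apply/measurable_EFinP; apply: measurable_funM => //; exact: mabs.
    - move=> u _; rewrite EFinM -KE -ge0_integralZl//; last first.
        by apply/measurable_EFinP; exact: mabs.
      apply: ge0_le_integral => //.
      + apply/measurable_EFinP; apply: (mabs (fun v => h (u, v))).
        exact: measurableT_comp.
      + by apply/measurable_EFinP; apply: measurable_funM => //; exact: mabs.
      + move=> v _; rewrite lee_fin /h !normrM ler_piMr//.
        by rewrite indicE ger0_norm ?ler0n// lern1 leq_b1.
  under eq_integral do rewrite EFinM.
  rewrite ge0_integralZr//; last 2 first.
    by apply/measurable_EFinP; exact: mabs.
    by rewrite -KE integral_ge0.
  move/integrableP : fi' => [_]; rewrite -ge0_fin_numE ?integral_ge0//.
  by move/fineK => <-; rewrite -EFinM ltry.
have subr u : u \in `[a, b] -> `[a, u] `<=` `[a, b].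
  by rewrite in_itv/= => /andP[_ ub]; apply: subset_itvl; rewrite bnd_simp.
have subl u : u \in `[a, b] -> `[u, b] `<=` `[a, b].
  by rewrite in_itv/= => /andP[au _]; apply: subset_itvr; rewrite bnd_simp.
transitivity (fine (\int[mu]_u \int[mu]_v (h (u, v))%:E)%E).
  apply: (congr1 fine); rewrite [LHS]integral_mkcond; apply: eq_integral => u _.
  rewrite patchE; case: ifPn => [|uab].
    rewrite inE/= => uab.
    have gu : mu.-integrable `[a, u] (EFin \o g).
      by apply: integrableS gi => //; exact: subr.
    rewrite EFinM fineK; last exact: integrable_fin_num.
    rewrite -integralZl// [LHS]integral_mkcond; apply: eq_integral => v _.
    rewrite patchE/= /h/= /f' /g' !patchE [u \in _]mem_set//.
    move: uab; rewrite in_itv/= => /andP[au ub].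
    case: ifPn => [|vau]; rewrite ?inE/= ?in_itv/=.
      move=> /andP[av vu].
      rewrite [v \in _]mem_set/=; last by rewrite in_itv/= av (le_trans vu).
      by rewrite indicE mem_set/= ?mulr1.
    move: vau; rewrite notin_setE/= in_itv/= => /negP; rewrite negb_and -!ltNge.
    case/orP => [va|uv].
      by rewrite [v \in _]memNset ?mulr0 ?mul0r//= in_itv/= leNgt va.
    by rewrite indicE [_ \in D]memNset ?mulr0//=; apply/negP; rewrite -ltNge.
  rewrite integral0_eq// => v _.
  by rewrite /h/= /f' patchE (negbTE uab) !mul0r.
rewrite (Fubini ih).
apply: (congr1 fine); rewrite [RHS]integral_mkcond; apply: eq_integral => v _.
rewrite patchE; case: ifPn => [|vab].
  rewrite inE/= => vab.
  have fv : mu.-integrable `[v, b] (EFin \o f).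
    by apply: integrableS fi => //; exact: subl.
  rewrite EFinM fineK; last exact: integrable_fin_num.
  rewrite -integralZl// [RHS]integral_mkcond; apply: eq_integral => u _.
  rewrite patchE/= /h/= /f' /g' !patchE [v \in _]mem_set//.
  move: vab; rewrite in_itv/= => /andP[av vb].
  case: ifPn => [|uab].
    rewrite inE/= in_itv/= => /andP[au ub].
    case: ifPn => [|uvb]; rewrite ?inE/= ?in_itv/=.
      by move=> /andP[vu _]; rewrite indicE mem_set/= ?mulr1 1?mulrC.
    rewrite indicE memNset ?mulr0//=.
    move: uvb; rewrite notin_setE/= in_itv/= => /negP; rewrite negb_and -!ltNge.
    by case/orP => [uv|]; [apply/negP; rewrite -ltNge|rewrite ltNge ub].
  rewrite !mul0r; case: ifPn => //; rewrite inE/= in_itv/= => /andP[vu ub].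
  move: uab; rewrite notin_setE/= in_itv/= => /negP.
  by rewrite ub (le_trans av vu).
rewrite integral0_eq// => u _.
by rewrite /h/= /g' patchE (negbTE vab) mulr0 mul0r.
Qed.

(** Gronwall's inequality along one path.  The right-hand side depends on m
    only through a quantity whose expectation vanishes when m is a martingale:
    it is the integral of exp(-C u) against dm, integrated by parts so that it
    makes sense for any integrable m.  The two sides differ by the integral of
    exp(-C u) (C y - z), which is nonnegative. *)
Lemma gronwall_path C y z m a b : 0 < C -> a <= b ->
  mu.-integrable `[a, b] (EFin \o y) -> mu.-integrable `[a, b] (EFin \o z) ->
  (forall u, u \in `[a, b] -> z u <= C * y u) ->
  (forall u, u \in `[a, b] ->
    m u = m a + (y u - y a) - \int[mu]_(v in `[a, u]) z v) ->
  expR (- (C * b)) * y b <= expR (- (C * a)) * y a +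
    (expR (- (C * b)) * m b - expR (- (C * a)) * m a +
     C * \int[mu]_(u in `[a, b]) (expR (- (C * u)) * m u)).
Proof.
move=> C0 ab iy iz zy mE; have Cn0 : C != 0 by rewrite gt_eqF.
pose e u := expR (- (C * u)).
have ce : continuous e by exact: continuous_expRN.
have ie : mu.-integrable `[a, b] (EFin \o e).
  apply: continuous_compact_integrable; first exact: segment_compact.
  exact: continuous_subspaceT.
have ieM (k : R -> R) : mu.-integrable `[a, b] (EFin \o k) ->
    mu.-integrable `[a, b] (EFin \o (fun u => e u * k u)).
  move=> ik.
  have -> : EFin \o (fun u => e u * k u) = ((EFin \o e) \* (EFin \o k))%E by [].
  apply: integrableMr => //.
    by apply: measurable_funTS; exact: continuous_measurable_fun.
  exists (e a); split; first exact: num_real.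
  move=> x ex u; rewrite /= in_itv/= => /andP[au _].
  rewrite (le_trans _ (ltW ex))// /e ger0_norm ?expR_ge0// ler_expR lerN2.
  by rewrite ler_wpM2l// ltW.
pose D u := \int[mu]_(v in `[a, u]) z v.
have iD : mu.-integrable `[a, b] (EFin \o D).
  apply: continuous_compact_integrable; first exact: segment_compact.
  exact: parameterized_integral_continuous.
have Ce : C * \int[mu]_(u in `[a, b]) e u = e a - e b by exact: Rintegral_expRN.
have intE : \int[mu]_(u in `[a, b]) (expR (- (C * u)) * m u)
  = (m a - y a) * \int[mu]_(u in `[a, b]) e u +
    \int[mu]_(u in `[a, b]) (e u * y u) - \int[mu]_(u in `[a, b]) (e u * D u).
  rewrite -RintegralZl// -RintegralD//; last 2 first.
  - exact: integrable_EFinM.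
  - exact: ieM.
  rewrite -RintegralB//; last 2 first.
  - by apply: integrable_EFinD => //; [exact: integrable_EFinM|exact: ieM].
  - exact: ieM.
  apply: eq_Rintegral => u; rewrite inE => /mE ->; rewrite -/(D u) /e; ring.
have triE : C * \int[mu]_(u in `[a, b]) (e u * D u) =
   \int[mu]_(u in `[a, b]) (e u * z u) - e b * D b.
  rewrite Rintegral_triangle//.
  have -> : \int[mu]_(v in `[a, b]) (z v * \int[mu]_(u in `[v, b]) e u) =
     \int[mu]_(v in `[a, b]) (C^-1 * (e v * z v) - C^-1 * e b * z v).
    apply: eq_Rintegral => v; rewrite inE/= in_itv/= => /andP[av vb].
    by rewrite -(mulKf Cn0 (Rintegral _ _ _)) Rintegral_expRN// /e; ring.
  rewrite RintegralB//; last 2 first.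
    by apply: integrable_EFinM => //; exact: ieM.
    exact: integrable_EFinM.
  by rewrite !RintegralZl// ?ieM// mulrBr !mulrA divff// !mul1r.
have zyE : \int[mu]_(u in `[a, b]) (e u * z u) <=
           C * \int[mu]_(u in `[a, b]) (e u * y u).
  rewrite -RintegralZl//; last exact: ieM.
  apply: le_Rintegral => //; first exact: ieM.
    by apply: integrable_EFinM => //; exact: ieM.
  move=> u uab; rewrite mulrCA ler_wpM2l ?expR_ge0//; exact: zy.
rewrite intE mE; last by rewrite in_itv/= ab lexx.
rewrite -/(D b) -/(e a) -/(e b).
rewrite !mulrBr !mulrDr triE mulrCA Ce.
move: zyE; rewrite -subr_ge0.
set Iy := C * _; set Iz := Rintegral _ _ _ => zyE.
rewrite [leRHS](_ : _ = e b * y b + (Iy - Iz)); last by ring.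
by rewrite lerDl.
Qed.

End real_line.

(** * Measurability of cadlag processes and Fubini's theorem *)

Section dyadic_times.
Context {R : realType}.
Implicit Types (s : R) (m : nat).

(** The first dyadic time of level m strictly after s.  Being strictly after s,
    it suits paths that are only right-continuous. *)
Definition dyadic_after m s : R := (Num.truncn (s * 2 ^+ m)).+1%:R / 2 ^+ m.

Lemma dyadic_after_itv m s : 0 <= s ->
  s < dyadic_after m s <= s + (2 ^+ m)^-1.
Proof.
move=> s0; have p0 : 0 < 2 ^+ m :> R by rewrite exprn_gt0.
have /truncn_itv/andP[lo hi] : 0 <= s * 2 ^+ m by rewrite mulr_ge0// ltW.
rewrite /dyadic_after ltr_pdivlMr// hi/= ler_pdivrMr// mulrDl mulVf ?gt_eqF//.
by rewrite -natr1 lerD2r.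
Qed.

Lemma cvg_dyadic_after (f : R -> R) s : 0 <= s ->
  f u @[u --> s^'+] --> f s -> f (dyadic_after m s) @[m --> \oo] --> f s.
Proof.
move=> s0 /cvg_at_rightP; apply; split.
  by move=> m; case/andP: (dyadic_after_itv m s0).
apply: (@squeeze_cvgr _ _ _ _ (cst s) (fun m => s + (2 ^+ m)^-1)).
- near=> m; case/andP: (dyadic_after_itv m s0) => /ltW -> ->//.
- exact: cvg_cst.
- rewrite -[X in _ --> X]addr0; apply: cvgD; first exact: cvg_cst.
  under eq_fun do rewrite -exprVn.
  by apply: cvg_expr; rewrite ger0_norm ?invr_ge0// invf_lt1// ltr1n.
Unshelve. all: end_near.
Qed.

End dyadic_times.

Section processes.
Context d (Omega : measurableType d) (R : realType).
Implicit Types (Y : R -> Omega -> R) (G : set (set Omega)).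

Lemma measurable_wrt_preimage G (Z : Omega -> R) : sigma_algebra setT G ->
  measurable_wrt G Z -> forall B, measurable B -> G (Z @^-1` B).
Proof.
move=> sG mZ B mB; have := mZ measurableT B mB.
by rewrite setTI /measurable/= sigma_algebra_id.
Qed.

Lemma measurable_wrtW d' (U : measurableType d') G (Z : Omega -> U) :
  sigma_algebra setT G -> G `<=` measurable ->
  measurable_wrt G Z -> measurable_fun setT Z.
Proof.
move=> sG Gm mZ _ B mB; have := mZ measurableT B mB; rewrite !setTI.
by rewrite /measurable/= sigma_algebra_id//; exact: Gm.
Qed.

(** Joint measurability: Y is the pointwise limit of its values at the dyadic
    times that follow, and between two successive dyadic times each of these
    approximations coincides with one of the Y_t.  The cut-off at 0 is there
    because nothing is known of Y at negative times. *)
Lemma measurable_process Y :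
  (forall t, 0 <= t -> measurable_fun setT (Y t)) ->
  (forall w, cadlag_path (Y ^~ w)) ->
  measurable_fun [set: R * Omega] (fun p => Y (Num.max 0 p.1) p.2).
Proof.
move=> mY cY.
apply: (@measurable_fun_cvg _ _ _ setT
  (fun m (p : R * Omega) => Y (dyadic_after m (Num.max 0 p.1)) p.2)); last first.
  move=> [s w] _ /=; have s0 : 0 <= Num.max 0 s by rewrite le_max lexx.
  exact: (@cvg_dyadic_after _ (Y ^~ w) _ s0 ((cY w).1 _ s0)).
move=> m _ B mB; rewrite setTI.
have p0 : 0 < 2 ^+ m :> R by rewrite exprn_gt0.
rewrite [X in measurable X](_ : _ = \bigcup_k
  (((fun p : R * Omega => Num.max 0 p.1 * 2 ^+ m) @^-1` `[k%:R, k.+1%:R[) `&`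
   (snd @^-1` (Y (k.+1%:R / 2 ^+ m) @^-1` B)))).
  apply: bigcupT_measurable => k; apply: measurableI.
    rewrite -[X in measurable X]setTI; apply: measurable_funM => //.
    by apply: measurable_maxr => //.
  rewrite -[X in measurable X]setTI.
  have mYk : measurable_fun setT (Y (k.+1%:R / 2 ^+ m)).
    by apply: mY; rewrite divr_ge0// ltW.
  exact: (measurableT_comp mYk measurable_snd).
apply/seteqP; split=> [[s w] /= YB|[s w] [k _ [/=]]].
  exists (Num.truncn (Num.max 0 s * 2 ^+ m)) => //; split => //=.
  by rewrite in_itv/= truncn_itv// mulr_ge0 ?le_max ?lexx// ltW.
rewrite in_itv/= => /truncn_def kE YB.
by rewrite /dyadic_after kE.
Qed.

End processes.

Section cadlag_integrability.
Context {R : realType}.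
Notation mu := (@lebesgue_measure R).

(** The time change phi allows for stopped paths, with phi u = min u rho. *)
Lemma cadlag_comp_integrable (f phi : R -> R) a b T : cadlag_path f ->
  measurable_fun setT phi -> (forall u, a <= u <= b -> 0 <= phi u <= T) ->
  mu.-integrable `[a, b] (EFin \o (fun u => f (phi u))).
Proof.
move=> cf mphi phiT.
have mf : measurable_fun setT (fun u : R => f (Num.max 0 u)).
  have mF := @measurable_process _ (measurableTypeR R) R (fun t _ => f t)
    (fun t _ => measurable_cst _) (fun _ => cf).
  exact: (measurableT_comp mF (pair2_measurable (0 : R))).
apply: measurable_bounded_integrable => //.
- by rewrite /= lebesgue_measure_itv/=; case: ifP => _; rewrite -?EFinD ltry.
- apply: (@eq_measurable_fun _ _ _ _ _ (fun u => f (Num.max 0 (phi u)))).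
    move=> u /[1!inE]/=; rewrite in_itv/= => /phiT/andP[u0 _].
    by congr f; apply/max_idPr.
  by apply: measurable_funTS; exact: (measurableT_comp mf mphi).
have [M MY] := cadlag_bounded T cf.
exists M; split; first exact: num_real.
move=> x Mx u; rewrite /= in_itv/= => uab.
by apply: le_trans (ltW Mx); apply: MY; exact: phiT.
Qed.

Lemma cadlag_integrable (f : R -> R) a b : 0 <= a -> cadlag_path f ->
  mu.-integrable `[a, b] (EFin \o f).
Proof.
move=> a0 cf; apply: (@cadlag_comp_integrable f id a b b) => //.
by move=> u /andP[/(le_trans a0) -> ->].
Qed.

End cadlag_integrability.

Section Fubini_process.
Context d (Omega : measurableType d) (R : realType).
Notation mu := (@lebesgue_measure R).
Implicit Types (Y : R -> Omega -> R).
Variable Q : probability Omega R.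

Lemma Fubini_process Y K a b : 0 <= a -> a <= b ->
  (forall t, 0 <= t -> measurable_fun setT (Y t)) ->
  (forall w, cadlag_path (Y ^~ w)) ->
  (forall u, a <= u <= b -> (\int[Q]_w `|(Y u w)%:E| <= K%:E)%E) ->
  forall A, measurable A ->
  [/\ Q.-integrable A (fun w => (\int[mu]_(u in `[a, b]) Y u w)%:E),
      mu.-integrable `[a, b] (fun u => (\int[Q]_(w in A) Y u w)%:E) &
   \int[Q]_(w in A) \int[mu]_(u in `[a, b]) Y u w =
   \int[mu]_(u in `[a, b]) \int[Q]_(w in A) Y u w].
Proof.
move=> a0 ab mY cY YK A mA.
pose g (u : R) := Num.max 0 u.
have mg : measurable_fun setT (fun p : Omega * R => Y (g p.2) p.1).
  have mswap := @measurable_swap _ _ Omega R.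
  exact: (measurableT_comp (measurable_process mY cY) mswap).
pose h (p : Omega * R) := Y (g p.2) p.1 * (\1_`[a, b] p.2 * \1_A p.1).
have mh : measurable_fun setT h.
  apply: measurable_funM => //; apply: measurable_funM.
    have m1 : measurable_fun setT (\1_`[a, b] : R -> R) by exact: measurable_indic.
    exact: (measurableT_comp m1 measurable_snd).
  have m1 : measurable_fun setT (\1_A : Omega -> R) by exact: measurable_indic.
  exact: (measurableT_comp m1 measurable_fst).
have gE u : u \in `[a, b] -> g u = u.
  by rewrite in_itv/= => /andP[au _]; apply/max_idPr; exact: le_trans au.
have mYu u : u \in `[a, b] -> measurable_fun setT (Y u).
  by rewrite in_itv/= => /andP[/(le_trans a0)] /mY.
have meh : measurable_fun setT (EFin \o h) by exact/measurable_EFinP.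
have mah : measurable_fun setT (abse \o (EFin \o h)).
  exact/measurableT_comp.
have mG : measurable_fun setT (fun u => \int[Q]_w `|(h (w, u))%:E|)%E.
  exact: (@measurable_fun_fubini_tonelli_G _ _ _ _ R Q _ mah (fun p => abse_ge0 _)).
have ih : (Q \x mu)%E.-integrable setT (EFin \o h).
  apply/integrable21ltyP; first exact/measurable_EFinP.
  apply: (@le_lt_trans _ _ (\int[mu]_(u in `[a, b]) K%:E)%E); last first.
    rewrite integral_cst//= lebesgue_measure_itv/=.
    by case: ifP => _; rewrite -?EFinD -?EFinM ?mule0 ltry.
  rewrite [leRHS]integral_mkcond; apply: ge0_le_integral => //.
  - by move=> u _; exact: integral_ge0.
  - by apply/(measurable_restrictT _ _).1.
  - move=> u _; rewrite patchE; case: ifPn => uab; last first.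
      by rewrite integral0_eq// => w _; rewrite /h/= indicE (negbTE uab) mul0r mulr0 normr0.
    rewrite inE/= in uab.
    apply: le_trans (YK u _); last by move: uab; rewrite in_itv.
    apply: ge0_le_integral => //.
    + apply/measurable_EFinP; apply: measurableT_comp => //.
      exact: (measurableT_comp mh).
    + by apply/measurable_EFinP; apply: measurableT_comp => //; exact: mYu.
    + move=> w _; rewrite lee_fin /h/= gE// normrM ler_piMr//.
      rewrite !indicE normrM !ger0_norm ?ler0n//.
      by rewrite mulr_ile1 ?ler0n// lern1 leq_b1.
have iu w : mu.-integrable `[a, b] (fun u => (Y u w)%:E).
  exact: cadlag_integrable.
have iw u : u \in `[a, b] -> Q.-integrable A (fun w => (Y u w)%:E).
  move=> uab; apply: (@integrableS _ _ _ _ setT) => //.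
  apply/integrableP; split; first by apply/measurable_EFinP; exact: mYu.
  by rewrite (le_lt_trans (YK u _)) ?ltry//; move: uab; rewrite in_itv.
have hw : (fun w => \int[mu]_u (h (w, u))%:E)%E =
    (fun w => (\int[mu]_(u in `[a, b]) Y u w)%:E) \_ A.
  apply/funext => w; rewrite patchE; case: ifPn => wA; last first.
    by rewrite integral0_eq// => u _; rewrite /h/= !indicE (negbTE wA) !mulr0.
  rewrite fineK; last exact: (integrable_fin_num _ (iu w)).
  rewrite [RHS]integral_mkcond; apply: eq_integral => u _.
  rewrite patchE /h/= !indicE wA mulr1; case: ifPn => uab; last by rewrite mulr0.
  by rewrite mulr1 gE//; move: uab; rewrite inE.
have hu : (fun u => \int[Q]_w (h (w, u))%:E)%E =
    (fun u => (\int[Q]_(w in A) Y u w)%:E) \_ `[a, b].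
  apply/funext => u; rewrite patchE; case: ifPn => uab; last first.
    by rewrite integral0_eq// => w _; rewrite /h/= !indicE (negbTE uab) !mul0r mulr0.
  rewrite inE/= in uab.
  rewrite fineK; last exact: (integrable_fin_num _ (iw u uab)).
  rewrite [RHS]integral_mkcond; apply: eq_integral => w _.
  rewrite patchE /h/= !indicE mem_set//= mul1r gE//.
  by case: ifPn => wA; rewrite ?mulr1 ?mulr0.
split.
- by rewrite integrable_mkcond// -hw; exact: integrable_fubini_F ih.
- rewrite integrable_mkcond// -hu; apply/integrableP; split.
    exact: measurable_fubini_G ih.
  have lty := (@integrable21ltyP _ _ _ _ R Q mu _ meh).1 ih; apply: le_lt_trans lty.
  apply: ge0_le_integral => //.
  + by apply: measurableT_comp => //; exact: measurable_fubini_G ih.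
  + by move=> u _; apply: le_abse_integral => //; exact: measurableT_comp meh _.
- have := Fubini ih; rewrite /= hw hu -!integral_mkcond.
  by move=> /(congr1 fine).
Qed.

End Fubini_process.

(** * Martingales *)

Section ae_fatou.
Local Open Scope ereal_scope.
Context d (T : measurableType d) (R : realType).
Variables (nu : {measure set T -> \bar R}) (D : set T) (mD : measurable D).

(** Fatou's lemma, for sequences that converge almost everywhere only. *)
Lemma ge0_ae_cvg_le_integral (f_ : (T -> \bar R)^nat) f c :
  (forall k, measurable_fun D (f_ k)) -> measurable_fun D f ->
  (forall k x, D x -> 0 <= f_ k x) -> (forall x, D x -> 0 <= f x) ->
  {ae nu, forall x, D x -> f_ ^~ x @ \oo --> f x} ->
  (forall k, \int[nu]_(x in D) f_ k x <= c) ->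
  \int[nu]_(x in D) f x <= c.
Proof.
move=> mf_ mf f_0 f0 f_f f_c.
apply: (@le_trans _ _ (\int[nu]_(x in D) limn_einf (f_ ^~ x))).
  apply: ae_ge0_le_integral => //.
  - move=> x Dx; rewrite limn_einf_lim; apply: lime_ge.
      exact: is_cvg_einfs.
    by apply: nearW => k; apply: le_ereal_inf_tmp => _ [j _ <-]; exact: f_0.
  - have mN k := measurableT_comp (@oppe_measurable R setT) (mf_ k).
    exact: (measurableT_comp (@oppe_measurable R setT) (measurable_fun_limn_esup mN)).
  - apply: filterS f_f => x xf Dx.
    by have [-> _] := cvg_limn_einf_sup (xf Dx).
apply: (le_trans (fatou _ mD mf_ f_0)).
apply: (le_trans (limn_einf_sup _)).
rewrite limn_esup_lim; apply: lime_le.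
  exact: is_cvg_esups.
by apply: nearW => k; apply: ge_ereal_sup => _ [j _ <-].
Qed.

End ae_fatou.

Section martingales.
Context d (Omega : measurableType d) (R : realType).
Variables (Q : probability Omega R) (F : R -> set (set Omega)).
Hypothesis filF : filtration F.
Notation mu := (@lebesgue_measure R).

Let sF t : 0 <= t -> sigma_algebra setT (F t).
Proof. by case: filF => h _ _; exact: h. Qed.

Let Fm t A : 0 <= t -> F t A -> measurable A.
Proof. by case: filF => _ h _ /h; exact. Qed.

Lemma adapted_measurable d' (U : measurableType d') (Y : R -> Omega -> U) t :
  adapted F Y -> 0 <= t -> measurable_fun setT (Y t).
Proof.
move=> aY t0; apply: (measurable_wrtW (sF t0)) => //.
  by move=> A; exact: Fm.
exact: aY.
Qed.

Lemma martingale_integral M s t A : martingale Q F M -> 0 <= s -> s <= t ->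
  F s A -> \int[Q]_(w in A) M s w = \int[Q]_(w in A) M t w.
Proof.
by case=> _ _ _ cM s0 st FA; have [_ _ _ /(_ _ FA)/(congr1 fine)] := cM _ _ s0 st.
Qed.

(** The L1 norm of a martingale is nondecreasing: on each of the two
    F_s-measurable sets where M_s has constant sign, replace M_s by M_t. *)
Lemma martingale_L1_le M s t : martingale Q F M -> 0 <= s -> s <= t ->
  \int[Q]_w `|M s w| <= \int[Q]_w `|M t w|.
Proof.
move=> mM s0 st; have [_ aM iM _] := mM.
have t0 := le_trans s0 st.
pose A := M s @^-1` `[0, +oo[.
have FA : F s A by apply: measurable_wrt_preimage => //; [exact: sF|exact: aM].
have FAC : F s (~` A).
  by rewrite -setTD; have [_ h _] := sF s0; exact: h.
have mA := Fm s0 FA.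
have mAC := measurableC mA.
have iS u B : 0 <= u -> measurable B -> Q.-integrable B (EFin \o M u).
  by move=> u0 mB; exact: integrableS (iM u u0).
have iN u B : 0 <= u -> measurable B -> Q.-integrable B (EFin \o (fun w => `|M u w|)).
  by move=> u0 mB; exact/integrable_norm/iS.
have split u : 0 <= u -> \int[Q]_w `|M u w| =
    \int[Q]_(w in A) `|M u w| + \int[Q]_(w in ~` A) `|M u w|.
  move=> u0; rewrite -Rintegral_setU ?setUv//.
    exact: iN.
  by apply/disj_setPS; rewrite setICr.
rewrite !split//; apply: lerD.
  rewrite [leLHS](_ : _ = \int[Q]_(w in A) M s w).
    rewrite (martingale_integral mM s0 st FA).
    apply: le_Rintegral => //; [exact: iS|exact: iN|].
    by move=> w _; exact: ler_norm.
  apply: eq_Rintegral => w; rewrite inE/A/= in_itv/= andbT => w0.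
  by rewrite ger0_norm.
rewrite [leLHS](_ : _ = - \int[Q]_(w in ~` A) M s w).
  rewrite (martingale_integral mM s0 st FAC).
  rewrite -mulN1r -RintegralZl//; last exact: iS.
  apply: le_Rintegral => //; [|exact: iN|].
    by apply: integrable_EFinM => //; exact: iS.
  by move=> w _; rewrite mulN1r -normrN; exact: ler_norm.
rewrite -mulN1r -RintegralZl//; last exact: iS.
apply: eq_Rintegral => w; rewrite inE/A/= in_itv/= andbT => /negP.
by rewrite -ltNge => w0; rewrite mulN1r ltr0_norm.
Qed.

(** The variable G is the integral over [s, t] of exp(-C u) against dM_u, after
    integration by parts.  Its expectation on A is computed by Fubini, since
    the expectation of M_u on A does not depend on u >= s. *)
Lemma martingale_exp C M s t A : 0 < C -> martingale Q F M ->
  0 <= s -> s <= t -> F s A ->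
  let G w := expR (- (C * t)) * M t w - expR (- (C * s)) * M s w +
    C * \int[mu]_(u in `[s, t]) (expR (- (C * u)) * M u w) in
  Q.-integrable A (EFin \o G) /\ \int[Q]_(w in A) G w = 0.
Proof.
move=> C0 mM s0 st FA G; have [cM aM iM _] := mM.
have t0 := le_trans s0 st; have mA := Fm s0 FA.
have iS u B : 0 <= u -> measurable B -> Q.-integrable B (EFin \o M u).
  by move=> u0 mB; exact: integrableS (iM u u0).
pose Y u w := expR (- (C * u)) * M u w.
have [] := @Fubini_process _ _ _ Q Y (\int[Q]_w `|M t w|) s t s0 st _ _ _ A mA.
- move=> u u0; apply: measurable_funM => //; exact: adapted_measurable.
- by move=> w; exact: cadlag_path_expRN.
- move=> u /andP[su ut]; have u0 := le_trans s0 su.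
  apply: (@le_trans _ _ (\int[Q]_w `|(M u w)%:E|)%E).
    apply: ge0_le_integral => //.
    - apply/measurable_EFinP; apply: measurableT_comp => //.
      by apply: measurable_funM => //; exact: adapted_measurable.
    - apply/measurable_EFinP; apply: measurableT_comp => //.
      exact: adapted_measurable.
    - move=> w _; rewrite lee_fin /Y normrM ler_piMl// ger0_norm ?expR_ge0//.
      by rewrite -expR0 ler_expR oppr_le0 mulr_ge0// ltW.
  rewrite -(@fineK _ (\int[Q]_w `|(M u w)%:E|)%E).
    by rewrite lee_fin; exact: (martingale_L1_le mM).
  exact: (integrable_fin_num _ (integrable_abse (iM u u0))).
move=> iI _ IE.
have iG : Q.-integrable A (EFin \o G).
  apply: integrable_EFinD => //; last exact: integrable_EFinM.
  by apply: integrable_EFinB => //; apply: integrable_EFinM => //; exact: iS.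
split => //.
rewrite /G RintegralD//; last 2 first.
- by apply: integrable_EFinB => //; apply: integrable_EFinM => //; exact: iS.
- exact: integrable_EFinM.
rewrite RintegralB//; try by apply: integrable_EFinM => //; exact: iS.
rewrite !RintegralZl//; try exact: iS.
rewrite IE.
have -> : \int[mu]_(u in `[s, t]) \int[Q]_(w in A) Y u w =
   \int[mu]_(u in `[s, t]) ((\int[Q]_(w in A) M s w) * expR (- (C * u))).
  apply: eq_Rintegral => u; rewrite inE/= in_itv/= => /andP[su ut].
  rewrite RintegralZl//; last by apply: iS => //; exact: le_trans su.
  by rewrite -(martingale_integral mM s0 su FA) mulrC.
rewrite RintegralZl//; last first.
  apply: continuous_compact_integrable; first exact: segment_compact.
  exact: continuous_subspaceT (@continuous_expRN _ C).
rewrite -(martingale_integral mM s0 st FA) mulrCA Rintegral_expRN//.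
ring.
Qed.

End martingales.

(** * The supermartingale exp(-C t) Y_t *)

Section gronwall_stopped.
Context {R : realType}.
Notation mu := (@lebesgue_measure R).

Lemma Rintegral_itv_sub (z : R -> R) s v : 0 <= s -> s <= v ->
  mu.-integrable `[0, v] (EFin \o z) ->
  \int[mu]_(u in `[s, v]) z u =
  \int[mu]_(u in `[0, v]) z u - \int[mu]_(u in `[0, s]) z u.
Proof.
move=> s0 sv iz.
rewrite (@Rintegral_itvB _ z (BLeft 0) (BRight v) s iz)//.
rewrite Rintegral_itv_obnd_cbnd//; apply: integrableS iz => //.
by apply: subset_itvr; rewrite bnd_simp.
Qed.

(** [gronwall_path] for the path stopped at rho.  Stopping y and cutting z off
    after rho preserves z <= C y because y is nonnegative. *)
Lemma gronwall_stopped C (y z m : R -> R) c rho s t : 0 < C ->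
  0 <= s -> s <= rho -> rho <= t -> cadlag_path y ->
  (forall u, 0 <= u -> 0 <= y u) ->
  mu.-integrable `[0, t] (EFin \o z) ->
  (forall u, 0 <= u -> z u <= C * y u) ->
  (forall u, s <= u <= t -> m u =
    y (Num.min u rho) - y 0 - \int[mu]_(v in `[0, Num.min u rho]) z v - c) ->
  expR (- (C * t)) * y rho <= expR (- (C * s)) * y s +
    (expR (- (C * t)) * m t - expR (- (C * s)) * m s +
     C * \int[mu]_(u in `[s, t]) (expR (- (C * u)) * m u)).
Proof.
move=> C0 s0 sr rt cy y0 iz zy mE.
have st := le_trans sr rt; have r0 := le_trans s0 sr.
have := @gronwall_path R C (fun u => y (Num.min u rho)) (z \_ `[0, rho]) m s t C0 st.
rewrite !(min_idPl sr) (min_idPr rt); apply.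
- apply: (@cadlag_comp_integrable R y (fun u => Num.min u rho) s t rho) => //.
    exact: measurable_minr.
  by move=> u /andP[su _]; rewrite le_min (le_trans s0 su) r0 ge_min lexx orbT.
- rewrite -restrict_EFin; apply/integrable_restrict => //; apply: integrableS iz => //.
    exact: measurableI.
  by move=> u [] /=; rewrite !in_itv/= => /andP[su ->] _; rewrite (le_trans s0 su).
- move=> u; rewrite in_itv/= => /andP[su ut]; have u0 := le_trans s0 su.
  rewrite patchE; case: ifPn => [|_].
    by rewrite inE/= in_itv/= => /andP[_ /min_idPl ->]; exact: zy.
  by rewrite mulr_ge0 ?(ltW C0)// y0// le_min u0 r0.
move=> u; rewrite in_itv/= => /andP[su ut].
have sv : s <= Num.min u rho by rewrite le_min su sr.
have -> : \int[mu]_(v in `[s, u]) (z \_ `[0, rho]) v =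
    \int[mu]_(v in `[s, Num.min u rho]) z v.
  rewrite -Rintegral_mkcondr; congr Rintegral; apply/seteqP; split => v /=.
    by rewrite !in_itv/= le_min => -[/andP[-> ->] /andP[_ ->]].
  rewrite !in_itv/= le_min => /and3P[sv' -> ->].
  by rewrite sv' (le_trans s0 sv').
rewrite Rintegral_itv_sub//; last first.
  apply: integrableS iz => //; apply: subset_itvl.
  by rewrite bnd_simp ge_min ut.
rewrite !mE ?lexx ?su ?ut ?st// (min_idPl sr).
ring.
Qed.

End gronwall_stopped.

Section supermartingale.
Context d (Omega : measurableType d) (R : realType).
Variables (Q : probability Omega R) (F : R -> set (set Omega)).
Hypothesis filF : filtration F.
Notation mu := (@lebesgue_measure R).

Lemma stopping_time_gt (tau : Omega -> \bar R) s : stopping_time F tau ->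
  0 <= s -> F s [set w | (s%:E < tau w)%E].
Proof.
move=> [_ tauF] s0.
have [_ h _] : sigma_algebra setT (F s) by case: filF => h _ _; exact: h.
rewrite [X in F s X](_ : _ = setT `\` [set w | (tau w <= s%:E)%E]).
  by apply: h; exact: tauF.
rewrite setTD; apply/seteqP; split => w /=; rewrite ltNge; first by move/negP.
by move/negP.
Qed.

Lemma filtration_measurable t A : 0 <= t -> F t A -> measurable A.
Proof. by case: filF => _ h _ /h; exact. Qed.

Lemma filtration_setI t A B : 0 <= t -> F t A -> F t B -> F t (A `&` B).
Proof.
move=> t0.
have sF : sigma_algebra setT (F t) by case: filF => h _ _; exact: h.
rewrite -(sigma_algebra_id sF) => FA FB.
exact: (@measurableI _ (g_sigma_algebraType (F t))).
Qed.

(** On A /\ {s < tau_k}, which belongs to F_s, [gronwall_stopped] bounds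
    exp(-C t) Y_t 1_{t < tau_k} by exp(-C s) Y_s plus a variable of zero
    expectation; then let k tend to infinity.  Keeping the indicator of
    {t < tau_k} makes the limit a matter of Fatou's lemma, and restricting to
    {s < tau_k} makes the lower end of the inequality free of k. *)
Lemma exp_supermartingale C (Y Z : R -> Omega -> R) : 0 < C ->
  (forall t w, 0 <= t -> 0 <= Y t w) ->
  (forall t, 0 <= t -> measurable_fun setT (Y t)) -> cadlag Y ->
  (forall w t, 0 <= t -> mu.-integrable `[0, t] (fun s => (Z s w)%:E)) ->
  (forall s w, 0 <= s -> Z s w <= C * Y s w) ->
  local_martingale Q F
    (fun t w => Y t w - Y 0 w - \int[mu]_(s in `[0, t]) Z s w) ->
  forall s t A, 0 <= s -> s <= t -> F s A ->
    (\int[Q]_(w in A) (expR (- (C * t)) * Y t w)%:E <=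
     \int[Q]_(w in A) (expR (- (C * s)) * Y s w)%:E)%E.
Proof.
move=> C0 Y0 mY cY iZ ZY [_ _ [tau [stau tauoo mtau]]] s t A s0 st FA.
have t0 := le_trans s0 st.
have mA := filtration_measurable s0 FA.
pose N u w := expR (- (C * u)) * Y u w.
have N0 u w : 0 <= u -> 0 <= N u w by move=> u0; rewrite mulr_ge0 ?expR_ge0 ?Y0.
have mN u : 0 <= u -> measurable_fun setT (N u).
  by move=> u0; apply: measurable_funM => //; exact: mY.
pose B k := [set w | (t%:E < tau k w)%E].
have mB k : measurable (B k).
  exact: (filtration_measurable t0 (stopping_time_gt (stau k) t0)).
have [sfin|] := ltP (\int[Q]_(w in A) (N s w)%:E)%E +oo%E; last first.
  by rewrite leye_eq => /eqP ->; rewrite leey.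
have iN : Q.-integrable A (EFin \o N s).
  apply/integrableP; split; first by apply/measurable_EFinP/measurable_funTS/mN.
  by under eq_integral do rewrite gee0_abs ?lee_fin ?N0//.
apply: (@ge0_ae_cvg_le_integral _ _ _ Q A mA
   (fun k w => (N t w * \1_(B k) w)%:E)) => //.
- move=> k; apply/measurable_EFinP/measurable_funTS.
  by apply: measurable_funM; [exact: mN|exact: measurable_indic].
- by apply/measurable_EFinP/measurable_funTS; exact: mN.
- by move=> k w _; rewrite lee_fin mulr_ge0 ?N0.
- by move=> w _; rewrite lee_fin N0.
- apply: filterS tauoo => w [_ tauy] _.
  apply: cvg_near_cst; move/cvgeyPgt : tauy => /(_ t).
  by apply: filterS => k tk; rewrite indicE mem_set// mulr1.
move=> k.
pose M u w := Y u w - Y 0 w - \int[mu]_(s in `[0, u]) Z s w.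
pose m u w := stopped M (tau k) u w - M 0 w.
have mm : martingale Q F m by exact: mtau.
pose Ak := A `&` [set w | (s%:E < tau k w)%E].
have FAk : F s Ak by apply: filtration_setI => //; exact: stopping_time_gt.
have mAk := filtration_measurable s0 FAk.
have [] := martingale_exp filF C0 mm s0 st FAk.
set G := (fun w => _ + _) => iG G0.
have key w : Ak w -> N t w * \1_(B k) w <= N s w + G w.
  move=> [Aw sw]; rewrite /=.
  have [rho [srho rhot rhoE rhot_eq]] : exists rho, [/\ s <= rho, rho <= t,
      (forall u, s <= u <= t -> fine (Order.min u%:E (tau k w)) = Num.min u rho) &
      (w \in B k -> rho = t)].
    have : w \in B k -> (t%:E < tau k w)%E by rewrite inE.
    move: sw; rewrite /=; case: (tau k w) => [r| |] // sr tr.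
      rewrite lte_fin in sr; exists (Num.min t r); split.
      + by rewrite le_min st ltW.
      + by rewrite ge_min lexx.
      + by move=> u /andP[su ut]; rewrite -EFin_min/= minA (min_idPl ut).
      + by move=> /tr; rewrite lte_fin => /ltW/min_idPl.
    exists t; split => // u /andP[su ut].
    by rewrite (min_idPl (leey _)) (min_idPl ut).
  have := @gronwall_stopped R C (Y ^~ w) (Z ^~ w) (m ^~ w) (M 0 w) rho s t
    C0 s0 srho rhot (cY w) (fun u => @Y0 u w) (iZ w t t0) (fun u => @ZY u w).
  have mE u : s <= u <= t -> m u w = Y (Num.min u rho) w - Y 0 w
      - \int[mu]_(v in `[0, Num.min u rho]) Z v w - M 0 w.
    by move=> sut; rewrite /m /stopped rhoE.
  move=> /(_ mE); rewrite -/(G w) -/(N s w) => YG.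
  rewrite indicE; case: (boolP (w \in B k)) => [wB|_] /=.
    by rewrite mulr1; move: YG; rewrite (rhot_eq wB).
  rewrite mulr0; apply: le_trans YG.
  by rewrite mulr_ge0 ?expR_ge0// Y0// (le_trans s0).
have iNk : Q.-integrable Ak (EFin \o N s).
  by apply: integrableS iN => //; exact: subIsetl.
apply: (@le_trans _ _ (\int[Q]_(w in Ak) (N s w + G w)%:E)%E).
  rewrite [leLHS](_ : _ = \int[Q]_(w in Ak) (N t w * \1_(B k) w)%:E)%E.
    apply: ge0_le_integral => //.
    - by move=> w _; rewrite lee_fin mulr_ge0 ?N0.
    - apply/measurable_EFinP/measurable_funTS.
      by apply: measurable_funM; [exact: mN|exact: measurable_indic].
    - exact: measurable_int (integrable_EFinD mAk iNk iG).
  rewrite [LHS]integral_mkcond [RHS]integral_mkcond.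
  apply: eq_integral => w _; rewrite !patchE in_setI.
  case: (w \in A) => //=; case: ifPn => // ws; rewrite indicE memNset ?mulr0//.
  move=> tw; move: ws; rewrite notin_setE; apply => /=.
  by apply: le_lt_trans tw; rewrite lee_fin.
rewrite integralD_EFin//.
have -> : (\int[Q]_(x in Ak) (G x)%:E)%E = 0%E.
  by rewrite -(fineK (integrable_fin_num mAk iG)) -[fine _]/(Rintegral _ _ _) G0.
rewrite adde0; apply: ge0_subset_integral => //.
- by apply/measurable_EFinP/measurable_funTS; exact: mN.
- by move=> w _; rewrite lee_fin N0.
- exact: subIsetl.
Qed.

End supermartingale.

(** * Domination of the supremum *)

Section maximal_inequality.
Context d (Omega : measurableType d) (R : realType).
Variables (Q : probability Omega R) (F : R -> set (set Omega)).
Hypothesis filF : filtration F.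
Variable N : R -> Omega -> R.
Hypothesis aN : adapted F N.
Hypothesis N0 : forall t w, 0 <= t -> 0 <= N t w.
Hypothesis superN : forall s t A, 0 <= s -> s <= t -> F s A ->
  (\int[Q]_(w in A) (N t w)%:E <= \int[Q]_(w in A) (N s w)%:E)%E.

Let sF t : 0 <= t -> sigma_algebra setT (F t).
Proof. by case: filF => h _ _; exact: h. Qed.

(** One step of the discrete maximal inequality: Markov's inequality on the
    part of D where f exceeds lam, the other part being kept. *)
Lemma integral_truncation (D : set Omega) (f : Omega -> R) lam :
  measurable D -> measurable_fun setT f -> (forall w, 0 <= f w) -> 0 <= lam ->
  (\int[Q]_(w in D `&` [set w | (f w <= lam)%R]) (f w)%:E +
    lam%:E * Q (D `&` [set w | (lam < f w)%R]) <= \int[Q]_(w in D) (f w)%:E)%E.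
Proof.
move=> mD mf f0 lam0.
have mL : measurable [set w | f w <= lam].
  by rewrite -[X in measurable X]setTI; apply: measurable_fun_le.
have LE : [set w | lam < f w] = ~` [set w | f w <= lam].
  by apply/seteqP; split => w /=; rewrite ltNge => /negP.
have mf' E : measurable_fun E (EFin \o f) by apply/measurable_EFinP/measurable_funTS.
rewrite LE; set D1 := D `&` _; set D2 := D `&` _.
have mD1 : measurable D1 by exact: measurableI.
have mD2 : measurable D2 by apply: measurableI => //; exact: measurableC.
rewrite [leRHS](_ : _ = \int[Q]_(w in D1 `|` D2) (f w)%:E)%E; last first.
  by rewrite -setIUr setUv setIT.
rewrite ge0_integral_setU//; last 2 first.
- by move=> w _; rewrite lee_fin.
- by apply/disj_setPS => w [[_ /= h]] [_ /=]; exact.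
rewrite leeD2l// -integral_cst//.
apply: ge0_le_integral => //.
by move=> w [_ /negP]; rewrite -ltNge lee_fin => /ltW.
Qed.

(** Doob's argument: the integral of N over the event that lam has not been
    exceeded so far, plus lam times the probability that it has been, does not
    increase with time. *)
Lemma maximal_inequality_seq (t_ : nat -> R) lam J :
  0 <= t_ 0%N -> {homo t_ : i j / (i <= j)%N >-> i <= j} -> 0 <= lam ->
  let B := [set w | forall j, (j <= J)%N -> N (t_ j) w <= lam] in
  F (t_ J) B /\ (\int[Q]_(w in B) (N (t_ J) w)%:E + lam%:E * Q (~` B) <=
     \int[Q]_w (N (t_ 0%N) w)%:E)%E.
Proof.
move=> t0 t_nd lam0.
have t_0 j : 0 <= t_ j by rewrite (le_trans t0)// t_nd.
have mN j : measurable_fun setT (N (t_ j)) by exact: (adapted_measurable filF aN).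
have FL j : F (t_ j) [set w | N (t_ j) w <= lam].
  rewrite [X in F _ X](_ : _ = N (t_ j) @^-1` `]-oo, lam]); last first.
    by apply/seteqP; split => w /=; rewrite in_itv.
  by apply: measurable_wrt_preimage => //; [exact: sF|exact: aN].
elim: J => [|J [FB IH]] B.
  have -> : B = [set w | N (t_ 0%N) w <= lam].
    apply/seteqP; split => w; first by apply.
    by move=> /= w0 j; rewrite leqn0 => /eqP ->.
  split => //.
  have := @integral_truncation setT _ lam measurableT (mN 0%N) (fun w => N0 w t0) lam0.
  rewrite !setTI [X in (_ * Q X)%E](_ : _ = ~` [set w | N (t_ 0%N) w <= lam])//.
  by apply/seteqP; split => w /=; rewrite ltNge => /negP.
pose B' := [set w | forall j, (j <= J)%N -> N (t_ j) w <= lam].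
have BE : B = B' `&` [set w | N (t_ J.+1) w <= lam].
  apply/seteqP; split => [w Bw|w [B'w wJ] j]; last first.
    by rewrite leq_eqVlt => /predU1P[->//|]; exact: B'w.
  by split; [move=> j jJ; apply: Bw; exact: leqW|exact: Bw].
have FB' : F (t_ J.+1) B'.
  by have [_ _ mono] := filF; apply: (mono _ _ (t_0 J)) FB; exact: t_nd.
have FBJ : F (t_ J.+1) B by rewrite BE; exact: filtration_setI.
have mB' := filtration_measurable filF (t_0 _) FB'.
have mB := filtration_measurable filF (t_0 _) FBJ.
split => //.
have -> : ~` B = ~` B' `|` (B' `&` [set w | lam < N (t_ J.+1) w]).
  rewrite BE setCI; apply/seteqP; split => w /=.
    have [B'w [//|/negP]|] := pselect (B' w); last by left.
    by rewrite -ltNge => ?; right.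
  by move=> [?|[_]]; [left|rewrite ltNge => /negP; right].
have mL : measurable [set w | N (t_ J.+1) w <= lam].
  exact: filtration_measurable (FL J.+1).
have mL' : measurable [set w | lam < N (t_ J.+1) w].
  rewrite [X in measurable X](_ : _ = ~` [set w | N (t_ J.+1) w <= lam]).
    exact: measurableC.
  by apply/seteqP; split => w /=; rewrite ltNge => /negP.
rewrite measureU//; last 3 first.
- exact: measurableC.
- exact: measurableI.
- by apply/seteqP; split => w //= -[h [/h]].
rewrite ge0_muleDr ?measure_ge0// [X in (_ + X)%E]addeC addeA.
apply: le_trans IH; apply: leeD => //.
apply: le_trans (superN (t_0 J) (t_nd _ _ (leqnSn J)) FB).
by rewrite BE; apply: integral_truncation => // w; exact: N0.
Qed.

(** The exceptional set is the increasing union over m of the events that lam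
    is exceeded at some dyadic time of level m. *)
Lemma maximal_inequality K lam T : cadlag N ->
  (\int[Q]_w (N 0 w)%:E <= K%:E)%E -> 0 < lam ->
  exists U, [/\ measurable U, (Q U <= (K / lam)%:E)%E &
    forall w s, ~ U w -> 0 <= s <= T -> N s w <= lam].
Proof.
move=> cN NK lam0.
(* The dyadic time that follows s <= T may exceed T, but not T + 1. *)
pose k := (Num.truncn T).+2.
have Tk u : u <= T -> u + 1 <= k%:R.
  move=> uT; rewrite /k -natr1 lerD2r (le_trans uT)//.
  exact: ltW (truncnS_gt T).
pose t_ m j : R := j%:R / 2 ^+ m.
have p0 m : 0 < 2 ^+ m :> R by rewrite exprn_gt0.
pose B m := [set w | forall j, (j <= k * 2 ^ m)%N -> N (t_ m j) w <= lam].
have mB m : F (t_ m (k * 2 ^ m)%N) (B m) /\ (lam%:E * Q (~` B m) <= K%:E)%E.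
  have [||//|FB B_le] := @maximal_inequality_seq (t_ m) lam (k * 2 ^ m).
  - by rewrite /t_ mul0r.
  - by move=> i j ij; rewrite /t_ ler_pM2r ?invr_gt0// ler_nat.
  - exact: ltW.
  split => //; apply: le_trans NK.
  have -> : 0 = t_ m 0%N by rewrite /t_ mul0r.
  move: B_le.
  apply: le_trans; rewrite leeDr// integral_ge0// => w _.
  by rewrite lee_fin N0// divr_ge0// ltW.
have mBC m : measurable (~` B m).
  apply: measurableC; apply: (filtration_measurable filF _ (mB m).1).
  by rewrite divr_ge0// ltW.
exists (\bigcup_m ~` B m); split.
- exact: bigcupT_measurable.
- have cvgQ : (Q \o (fun m => ~` B m)) @ \oo --> Q (\bigcup_m ~` B m).
    apply: nondecreasing_cvg_mu => //; first exact: bigcupT_measurable.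
    move=> m m' mm'; apply/subsetPset/subsetC => w Bw j jk.
    have -> : t_ m j = t_ m' (j * 2 ^ (m' - m))%N.
      rewrite /t_ -{2}(subnK mm') natrM natrX exprD invfM.
      by rewrite -mulrA mulVKf ?gt_eqF.
    apply: Bw; apply: leq_trans (leq_mul jk (leqnn _)) _.
    by rewrite -mulnA -expnD addnC subnK.
  rewrite -(cvg_lim _ cvgQ)//; apply: lime_le; first by apply/cvg_ex; eexists; exact: cvgQ.
  by apply: nearW => m /=; rewrite EFinM muleC lee_pdivlMl//; exact: (mB m).2.
- move=> w s Uw /andP[s0 sT].
  have cv := cvg_dyadic_after s0 ((cN w).1 s s0).
  rewrite -(cvg_lim _ cv)//; apply: limr_le; first by apply/cvg_ex; eexists; exact: cv.
  apply: nearW => m.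
  have Bw : B m w by apply: contrapT => Bw; apply: Uw; exists m.
  apply: Bw; rewrite -(ler_nat R) natrM natrX -ler_pdivrMr//.
  have /andP[_ le1] := dyadic_after_itv m s0.
  apply: (le_trans le1); apply: le_trans (Tk s sT).
  by rewrite lerD2l invf_le1// exprn_ege1// ler1n.
Qed.

(** The weak-type bound Q(sup N > 4^j) <= K / 4^j makes the square root of
    sup N integrable: H is the sum of 1 and of the 2^(j+1) 1_(U j), where
    the event U j contains {sup N > 4^j}.  The value of H is infinite on the
    intersection of the U j. *)
Lemma square_dominated K T : cadlag N -> 0 <= K ->
  (\int[Q]_w (N 0 w)%:E <= K%:E)%E ->
  exists H : Omega -> \bar R, Q.-integrable setT H /\
    forall w s x, 0 <= s <= T -> x ^+ 2 <= N s w -> (`|x|%:E <= H w)%E.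
Proof.
move=> cN K0 NK.
have four0 j : 0 < 4 ^+ j :> R by rewrite exprn_gt0.
have /choice[U hU] j := maximal_inequality T cN NK (four0 j).
have mU j : measurable (U j) by case: (hU j).
pose h j (w : Omega) : \bar R := (2 ^+ j.+1 * \1_(U j) w)%:E.
have h0 j w : (0 <= h j w)%E by rewrite lee_fin mulr_ge0// exprn_ge0.
have mh j : measurable_fun setT (h j).
  by apply/measurable_EFinP; apply: measurable_funM => //; exact: measurable_indic.
pose H w := (1 + \sum_(j <oo) h j w)%E.
have H0 w : (0 <= H w)%E by rewrite adde_ge0// nneseries_ge0.
have mS : measurable_fun setT (fun w => \sum_(j <oo) h j w)%E.
  exact: (@ge0_emeasurable_sum _ _ _ setT h xpredT (fun j w _ _ => h0 j w) (fun j _ => mh j)).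
exists H; split.
  apply/integrableP; split; first exact: emeasurable_funD.
  under eq_integral do rewrite gee0_abs//.
  rewrite ge0_integralD//; last by move=> w _; exact: nneseries_ge0.
  rewrite integral_cst// mul1e [X in (X + _)%E](_ : _ = 1%E); last exact: probability_setT.
  rewrite integral_nneseries//.
  apply: (@le_lt_trans _ _ (1 + (4 * K)%:E)%E); last by rewrite -EFinD ltry.
  rewrite leeD2l//; apply: le_trans (epsilon_trick0 xpredT _); last by rewrite mulr_ge0.
  apply: lee_nneseries => [j _|j _]; first by rewrite integral_ge0.
  rewrite /h; under eq_integral do rewrite EFinM.
  rewrite ge0_integralZl_EFin//; last by apply/measurable_EFinP; exact: measurable_indic.
  rewrite integral_indic// setIT; have [_ QU _] := hU j.
  rewrite (le_trans (lee_wpmul2l _ QU))// -EFinM lee_fin.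
  (* 2^(j+1) K / 4^j is exactly 4 K / 2^(j+1), the term of a geometric series. *)
  rewrite natrX -subr_ge0 (_ : _ - _ = 0)//.
  have -> : 4 ^+ j = 2 ^+ j * 2 ^+ j :> R by rewrite -exprMn -natrM.
  have p0 : 2 ^+ j != 0 :> R by rewrite expf_neq0.
  by rewrite !exprS; field.
move=> w s x sT xN.
have x_le j : N s w <= 4 ^+ j -> `|x| <= 2 ^+ j.
  move=> N4; rewrite -(@ler_pXn2r _ 2%N)// ?nnegrE ?exprn_ge0//.
  by rewrite real_normK ?num_real// -exprM mulnC exprM -natrX (le_trans xN).
have le_h i : U i w -> `|x| <= 2 ^+ i.+1 -> (`|x|%:E <= H w)%E.
  move=> Uw xi.
  apply: (@le_trans _ _ (h i w)).
    by rewrite lee_fin indicE mem_set// mulr1.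
  apply: (@le_trans _ _ (\sum_(0 <= j < i.+1) h j w)%E).
    by rewrite big_nat_recr//= leeDr// sume_ge0.
  apply: (@le_trans _ _ (\sum_(j <oo) h j w)%E).
    exact: nneseries_lim_ge.
  by rewrite leeDr.
have [allU|] := pselect (forall j, U j w).
  pose i := Num.truncn `|x|.
  apply: (le_h i) => //; apply: ltW; apply: lt_le_trans (truncnS_gt _) _.
  by rewrite -natrX ler_nat ltnW// ltn_expl.
move=> /existsNP exU.
have exU' : exists j, `[< ~ U j w >] by case: exU => j jU; exists j; exact/asboolP.
(* The least j outside U j: either it is 0, or U (j - 1) contributes 2^j. *)
case: (ex_minnP exU') => -[|i] /asboolP nU imin.
  have [_ _ /(_ w s nU sT)/x_le x1] := hU 0%N.
  apply: (@le_trans _ _ 1%E); last by rewrite leeDl// nneseries_ge0.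
  by rewrite lee_fin.
apply: (le_h i).
  apply: contrapT => nUi; have := imin i; rewrite ltnn => /(_ _)/negP; apply => //.
  exact/asboolP.
by have [_ _ /(_ w s nU sT)/x_le] := hU i.+1.
Qed.

End maximal_inequality.

Section dominated_local_martingale.
Context d (Omega : measurableType d) (R : realType).
Variables (Q : probability Omega R) (F : R -> set (set Omega)).
Hypothesis filF : filtration F.

(** The stopped processes M_{u /\ tau_k} - M_0 are martingales that converge to
    M_u - M_0 and are dominated by 2 H, so their expectations on A converge. *)
Lemma dominated_local_martingale M (H : Omega -> \bar R) T :
  local_martingale Q F M -> Q.-integrable setT H ->
  (forall w u, 0 <= u <= T -> (`|M u w|%:E <= H w)%E) ->
  forall s t A, 0 <= s -> s <= t -> t <= T -> F s A ->
  \int[Q]_(w in A) M s w = \int[Q]_(w in A) M t w.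
Proof.
move=> [_ aM [tau [stau tauoo mtau]]] iH MH s t A s0 st tT FA.
have mA := filtration_measurable filF s0 FA.
have t0 := le_trans s0 st; have T0 := le_trans t0 tT.
have mM u : 0 <= u -> measurable_fun setT (M u).
  exact: (adapted_measurable filF aM).
have iHA : Q.-integrable A H by exact: integrableS iH.
have iM u : 0 <= u <= T -> Q.-integrable A (EFin \o M u).
  move=> /[dup] uT /andP[u0 _]; apply: (le_integrable mA) iHA.
    by apply/measurable_EFinP/measurable_funTS; exact: mM.
  by move=> w _; rewrite (le_trans (MH w u uT))// lee_abs.
pose m k u w := stopped M (tau k) u w - M 0 w.
have cvgM u : 0 <= u <= T -> (\int[Q]_(w in A) (m k u w)%:E @[k --> \oo] -->
    \int[Q]_(w in A) (M u w - M 0 w)%:E)%E.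
  move=> /andP[u0 uT].
  have [] // := @dominated_convergence _ _ _ Q A mA (fun k w => (m k u w)%:E)
     (fun w => (M u w - M 0 w)%:E) (fun w => H w + H w)%E.
  - move=> k; apply/measurable_EFinP/measurable_funTS.
    have [_ am _ _] := mtau k; exact: (adapted_measurable filF am u0).
  - apply/measurable_EFinP/measurable_funTS.
    by apply: measurable_funB; exact: mM.
  - apply: filterS tauoo => w [_ tauy] _.
    apply: cvg_near_cst; move/cvgeyPgt : tauy => /(_ u).
    apply: filterS => k /ltW uk; rewrite /m /stopped.
    by rewrite (min_idPl uk).
  - exact: integrableD.
  - apply: aeW => w k _; rewrite /m EFinB.
    apply: le_trans (lee_abs_sub _ _) _; apply: leeD; apply: MH; last by rewrite lexx.
    have [+ _] := stau k; move=> /(_ w).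
    case: (tau k w) => [r| |] //= r0.
      rewrite -EFin_min/= le_min u0 -lee_fin r0/=.
      by rewrite (le_trans _ uT)// ge_min lexx.
    by rewrite (min_idPl (leey _)) u0.
have eqm k : (\int[Q]_(w in A) (m k s w)%:E)%E = (\int[Q]_(w in A) (m k t w)%:E)%E.
  by have [_ _ _ /(_ _ _ s0 st)[_ _ _ /(_ _ FA)]] := mtau k.
have eqM : (\int[Q]_(w in A) (M s w - M 0 w)%:E)%E =
           (\int[Q]_(w in A) (M t w - M 0 w)%:E)%E.
  have sT : 0 <= s <= T by rewrite s0 (le_trans st).
  have tT' : 0 <= t <= T by rewrite t0.
  have c1 := cvgM s sT; have c2 := cvgM t tT'.
  have mst : (fun k => \int[Q]_(w in A) (m k s w)%:E)%E =
             (fun k => \int[Q]_(w in A) (m k t w)%:E)%E by exact/funext.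
  move: c1; rewrite mst => c1.
  transitivity (lim ((fun k => \int[Q]_(w in A) (m k t w)%:E)%E @ \oo)).
    exact/esym/cvg_lim.
  exact/cvg_lim.
have := congr1 fine eqM.
rewrite -[fine _]/(Rintegral Q A (fun w => M s w - M 0 w)).
rewrite -[fine _]/(Rintegral Q A (fun w => M t w - M 0 w)).
rewrite !RintegralB//; try by apply: iM; rewrite ?lexx ?s0 ?t0 ?(le_trans st).
by move=> /addIr.
Qed.

End dominated_local_martingale.

(** * Linear integral equations *)

Section integral_taylor.
Context {R : realType}.
Notation mu := (@lebesgue_measure R).

(** Taylor's formula for a sequence in which f (k+1) plays the role of the
    derivative of f k.  The induction on the order n of the expansion treats
    all k at once, because its remainder for f k is the integral of the one of
    order n - 1 for f (k+1). *)
Lemma integral_taylor (f : nat -> R -> R) K c t T : t <= T -> 0 <= K -> 0 <= c ->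
  (forall k, mu.-integrable `[t, T] (EFin \o f k)) ->
  (forall k u, t <= u <= T -> `|f k u| <= K * c ^+ k) ->
  (forall k u, t <= u <= T -> f k u = f k t + \int[mu]_(v in `[t, u]) f k.+1 v) ->
  \sum_(0 <= j < n) ((T - t) ^+ j / j`!%:R * f j t) @[n --> \oo] --> f 0%N T.
Proof.
move=> tT K0 c0 fi fb fE.
pose P n k u := \sum_(0 <= j < n) ((u - t) ^+ j / j`!%:R * f (k + j)%N t).
have ci u (g : R -> R) : continuous g -> mu.-integrable `[t, u] (EFin \o g).
  move=> cg; apply: continuous_compact_integrable; first exact: segment_compact.
  exact: continuous_subspaceT.
have cpow j : continuous (fun u => (u - t) ^+ j / j`!%:R).
  move=> x; apply: cvgM; last exact: cvg_cst.
  have ca : {for x, continuous (fun u : R => u - t)}.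
    by apply: cvgB; [exact: cvg_id|exact: cvg_cst].
  exact: (continuous_comp ca (@exprn_continuous _ j _)).
have iP n k u : mu.-integrable `[t, u] (EFin \o P n k).
  elim: n => [|n IH].
    have -> : P 0%N k = cst 0 by apply/funext => v; rewrite /P big_geq.
    by apply: ci => x; exact: cvg_cst.
  have -> : P n.+1 k = fun v => P n k v + f (k + n)%N t * ((v - t) ^+ n / n`!%:R).
    by apply/funext => v; rewrite /P big_nat_recr//= [in X in _ + X]mulrC.
  by apply: integrable_EFinD => //; apply: integrable_EFinM => //; exact: ci.
have PS n k u : t <= u -> P n.+1 k u = f k t + \int[mu]_(v in `[t, u]) P n k.+1 v.
  move=> tu; elim: n => [|n IH].
    rewrite /P big_nat1 addn0 expr0 fact0 divr1 mul1r.
    rewrite [X in _ + X](_ : _ = 0) ?addr0//.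
    under eq_Rintegral do rewrite big_geq//.
    by rewrite Rintegral_cst// mul0r.
  have -> : P n.+2 k u = P n.+1 k u + (u - t) ^+ n.+1 / n.+1`!%:R * f (k + n.+1)%N t.
    by rewrite /P big_nat_recr.
  rewrite IH -addrA; congr (_ + _).
  have -> : P n.+1 k.+1 = fun v => P n k.+1 v +
      f (k + n.+1)%N t * ((v - t) ^+ n / n`!%:R).
    by apply/funext => v; rewrite /P big_nat_recr//= addSnnS [in X in _ + X]mulrC.
  rewrite RintegralD//; last by apply: integrable_EFinM => //; exact: ci.
  rewrite RintegralZl//; last exact: ci.
  by rewrite Rintegral_power// [in RHS]mulrC.
have rem n : forall k u, t <= u <= T ->
    `|f k u - P n k u| <= K * c ^+ (k + n) * ((u - t) ^+ n / n`!%:R).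
  elim: n => [|n IH] k u /[dup] utT /andP[tu uT].
    rewrite /P big_geq// subr0 expr0 fact0 divr1 mulr1 addn0; exact: fb.
  have sub : `[t, u] `<=` `[t, T] by apply: subset_itvl; rewrite bnd_simp.
  have fui j : mu.-integrable `[t, u] (EFin \o f j) by exact: integrableS (fi j).
  rewrite fE// PS// opprD addrACA subrr add0r -RintegralB//.
  apply: le_trans (le_normr_Rintegral _ _) _ => //; first exact: integrable_EFinB.
  rewrite -Rintegral_power// -RintegralZl//; last exact: ci.
  apply: le_Rintegral => //.
  - by apply: integrable_norm; exact: integrable_EFinB.
  - by apply: integrable_EFinM => //; exact: ci.
  - move=> v; rewrite /= in_itv/= => /andP[tv vu].
    by rewrite -addSnnS; apply: IH; rewrite tv (le_trans vu).
apply/cvgrPdist_le => e e0.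
have /cvgrPdist_le/(_ e e0) : K * ((c * (T - t)) ^+ n / n`!%:R) @[n --> \oo] --> 0.
  rewrite -[X in _ --> X](mulr0 K); apply: cvgM; first exact: cvg_cst.
  apply: cvg_series_cvg_0; exact: (is_cvg_series_exp_coeff (c * (T - t))).
apply: filterS => n; rewrite sub0r normrN => le_e.
apply: le_trans le_e; apply: le_trans (ler_norm _).
have := rem n 0%N T; rewrite /P; under eq_bigr do rewrite add0n.
rewrite tT lexx add0n => /(_ isT); rewrite exprMn. 
by rewrite -!mulrA.
Qed.

End integral_taylor.

Section matrix_exponential.
Context {R : realType} {n : nat}.
Implicit Types (B : 'M[R]_n.+1) (i j : 'I_n.+1) (u : R).

(** The sum of all entries, rather than a maximum, so that its k-th power bounds
    the entries of B^k; the exponential series of this number then dominates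
    that of B. *)
Definition entry_bound B : R := \sum_i \sum_j `|B i j|.

Lemma row_le_entry_bound B i : \sum_j `|B i j| <= entry_bound B.
Proof.
rewrite /entry_bound [leRHS](bigD1 i)//= lerDl; apply: sumr_ge0 => k _.
exact: sumr_ge0.
Qed.

Lemma entry_bound_ge0 B : 0 <= entry_bound B.
Proof. by apply: sumr_ge0 => k _; exact: sumr_ge0. Qed.

Lemma exprmx_le B k i j : `|(B ^+ k) i j| <= entry_bound B ^+ k.
Proof.
elim: k i j => [|k IH] i j.
  by rewrite !expr0 mxE; case: (i == j); rewrite ?normr1 ?normr0.
rewrite exprS mxE (le_trans (ler_norm_sum _ _ _))//.
rewrite [leRHS]exprS (le_trans _ (ler_wpM2r _ (row_le_entry_bound B i)))//.
  rewrite mulr_suml ler_sum// => l _.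
  by rewrite normrM ler_wpM2l.
by rewrite exprn_ge0// entry_bound_ge0.
Qed.

(** The exponential of u B, summed entry by entry. *)
Definition expmx_coeff B u i j : R^nat :=
  fun k => u ^+ k / k`!%:R * (B ^+ k) i j.

Definition expmx B u : 'M[R]_n.+1 :=
  \matrix_(i, j) limn (series (expmx_coeff B u i j)).

Lemma is_cvg_expmx B u i j : cvgn (series (expmx_coeff B u i j)).
Proof.
apply: normed_cvg.
apply: (@series_le_cvg _ _ (exp_coeff (`|u| * entry_bound B))).
- by move=> k /=.
- by move=> k; rewrite /exp_coeff/= divr_ge0// exprn_ge0// mulr_ge0// entry_bound_ge0.
- move=> k; rewrite /expmx_coeff /exp_coeff/= !normrM normfV normrX normr_nat.
  rewrite exprMn mulrAC; apply: ler_wpM2r; first by rewrite invr_ge0.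
  by apply: ler_wpM2l; [exact: exprn_ge0|exact: exprmx_le].
- exact: is_cvg_series_exp_coeff.
Qed.

Lemma measurable_expmx B i j : measurable_fun setT (fun u => expmx B u i j).
Proof.
apply: (@measurable_fun_cvg _ _ _ setT (fun k u => series (expmx_coeff B u i j) k)).
  move=> k; rewrite /series/=; apply: measurable_sum => l.
  by apply: measurable_funM => //; apply: measurable_funM.
by move=> u _; rewrite mxE; exact: is_cvg_expmx.
Qed.

End matrix_exponential.

(** * Processes with linear drift *)

Lemma cvg_lincomb {R : realType} (I : finType) (u : I -> R^nat) (l b : I -> R) :
  (forall i, u i n @[n --> \oo] --> l i) ->
  \sum_i u i n * b i @[n --> \oo] --> \sum_i l i * b i.
Proof.
move=> ul; elim: (index_enum I) => [|i s IH].
  by under eq_fun do rewrite big_nil; rewrite big_nil; exact: cvg_cst.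
under eq_fun do rewrite big_cons; rewrite big_cons.
by apply: cvgD => //; apply: cvgM => //; exact: cvg_cst.
Qed.

Section linear_drift.
Context d (Omega : measurableType d) (R : realType) (N : nat).
Variables (Q : probability Omega R) (F : R -> set (set Omega)).
Hypothesis filF : filtration F.
Notation mu := (@lebesgue_measure R).
Variables (B : 'M[R]_N.+1) (z : 'I_N.+1 -> R -> Omega -> R).
Hypothesis cz : forall k, cadlag (z k).
Hypothesis az : forall k, adapted F (z k).
Hypothesis dz : forall T, 0 <= T -> exists H : Omega -> \bar R,
  Q.-integrable setT H /\
  forall w s k, 0 <= s <= T -> (`|z k s w|%:E <= H w)%E.
Hypothesis Mz : forall k, local_martingale Q F (fun t w =>
  z k t w - z k 0 w - \int[mu]_(s in `[0, t]) (\sum_l B k l * z l s w)).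

Let mz k t : 0 <= t -> measurable_fun setT (z k t).
Proof. exact: (adapted_measurable filF (az k)). Qed.

Lemma linear_drift_integrable k t A : 0 <= t -> measurable A ->
  Q.-integrable A (EFin \o z k t).
Proof.
move=> t0 mA; have [H [iH zH]] := dz t0.
apply: (@integrableS _ _ _ _ setT) => //.
apply: (le_integrable measurableT) iH; first by apply/measurable_EFinP/mz.
move=> w _; apply: (le_trans _ (lee_abs _)); apply: zH.
by rewrite t0 lexx.
Qed.

(** The bound that Fubini's theorem needs, uniform over [0, T]. *)
Lemma linear_drift_bounded T : 0 <= T -> exists K, 0 <= K /\
  forall u k, 0 <= u <= T -> (\int[Q]_w `|(z k u w)%:E| <= K%:E)%E.
Proof.
move=> T0; have [H [iH zH]] := dz T0.
have H0 w : (0 <= H w)%E.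
  by apply: le_trans (zH w 0 ord0 _); rewrite ?lee_fin// lexx T0.
have fH := integrable_fin_num measurableT iH.
exists (fine (\int[Q]_w H w)%E); split.
  by rewrite fine_ge0// integral_ge0.
move=> u k uT; rewrite fineK//; apply: ge0_le_integral => //.
- apply/measurable_EFinP/measurableT_comp => //; apply: mz; by case/andP: uT.
- exact: measurable_int iH.
- by move=> w _; exact: zH.
Qed.

Let a A k u := \int[Q]_(w in A) z k u w.

(** The local martingales of the Doob decomposition of z are dominated, hence
    satisfy the martingale identity on A; Fubini turns it into a linear
    integral equation for the expectations of z on A. *)
Lemma linear_drift_equation t T A k : 0 <= t -> t <= T -> F t A ->
  a A k T = a A k t + \int[mu]_(u in `[t, T]) \sum_l B k l * a A l u.
Proof.
move=> t0 tT FA; have T0 := le_trans t0 tT.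
have mA := filtration_measurable filF t0 FA.
have [H [iH zH]] := dz T0.
have [K [K0 zK]] := linear_drift_bounded T0.
pose D u w := \int[mu]_(s in `[0, u]) (\sum_l B k l * z l s w).
have fub l u : 0 <= u <= T -> [/\ Q.-integrable A (fun w => (\int[mu]_(s in `[0, u]) z l s w)%:E),
      mu.-integrable `[0, u] (fun s => (a A l s)%:E) &
   \int[Q]_(w in A) \int[mu]_(s in `[0, u]) z l s w =
   \int[mu]_(s in `[0, u]) a A l s].
  move=> /andP[u0 uT].
  apply: (@Fubini_process _ _ _ Q (z l) K 0 u (lexx 0) u0 _ _ _ A mA).
  - exact: mz.
  - exact: cz.
  - by move=> s /andP[s0 su]; apply: zK; rewrite s0 (le_trans su).
have DE u w : 0 <= u -> D u w = \sum_l B k l * \int[mu]_(s in `[0, u]) z l s w.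
  move=> u0; rewrite /D Rintegral_lincomb// => l.
  exact: (cadlag_integrable u (lexx 0) (cz l w)).
have AD u : 0 <= u <= T -> Q.-integrable A (EFin \o D u) /\
    \int[Q]_(w in A) D u w = \int[mu]_(s in `[0, u]) \sum_l B k l * a A l s.
  move=> /[dup] uT /andP[u0 _].
  have -> : D u = fun w => \sum_l B k l * \int[mu]_(s in `[0, u]) z l s w.
    by apply/funext => w; exact: DE.
  split; first by apply: integrable_lincomb => // l; case: (fub l u uT).
  rewrite !Rintegral_lincomb//; try by move=> l; case: (fub l u uT).
  by apply: eq_bigr => l _; case: (fub l u uT) => _ _ ->.
pose c := \sum_l `|B k l|.
have c0 : 0 <= c by exact: sumr_ge0.
(* 2 H bounds the two values of z, and T c H bounds the drift term. *)
have Mbd w u : 0 <= u <= T ->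
    (`|z k u w - z k 0 w - D u w|%:E <= (2 + T * c)%:E * H w)%E.
  move=> /[dup] uT /andP[u0 u_le].
  have := zH w; case: (H w) => [h| |] zh.
  - have zh' s l : 0 <= s <= T -> `|z l s w| <= h.
      by move=> sT; rewrite -lee_fin; exact: zh.
    have h0 : 0 <= h by rewrite (le_trans _ (zh' 0 k _)) ?lexx.
    rewrite -EFinM lee_fin mulrDl.
    apply: le_trans (ler_normB _ _) _; apply: lerD.
      apply: le_trans (ler_normB _ _) _; rewrite mulr2n mulrDl !mul1r.
      by apply: lerD; apply: zh' => //; rewrite lexx.
    rewrite DE//; apply: le_trans (ler_norm_sum _ _ _) _.
    rewrite -mulrA mulrCA mulr_suml ler_sum// => l _; rewrite normrM ler_wpM2l//.
    apply: le_trans (le_normr_Rintegral _ _) _ => //; first exact: (cadlag_integrable u (lexx 0) (cz l w)).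
    apply: (@le_trans _ _ (\int[mu]_(s in `[0, u]) h)).
      apply: le_Rintegral => //.
      - by apply: integrable_norm; exact: (cadlag_integrable u (lexx 0) (cz l w)).
      - by apply: cadlag_integrable => //; split=> r r0; [|exists h]; exact: cvg_cst.
      - move=> r; rewrite /= in_itv/= => /andP[r0 ru].
        by apply: zh'; rewrite r0 (le_trans ru).
    rewrite Rintegral_cst//= lebesgue_measure_itv/= lte_fin.
    case: ifP => _ /=; rewrite ?subr0 ?mulr0 ?mulr_ge0//.
    by rewrite mulrC ler_wpM2r.
  - rewrite mulry gtr0_sg ?mul1e ?leey//.
    by rewrite ltr_wpDr// mulr_ge0.
  - by have := zh 0 k; rewrite lexx T0 => /(_ isT); rewrite leeNy_eq.
have tT' : 0 <= t <= T by rewrite t0.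
have TT : 0 <= T <= T by rewrite T0 lexx.
have iz u : 0 <= u -> Q.-integrable A (EFin \o z k u).
  by move=> u0; exact: linear_drift_integrable.
have AM u : 0 <= u <= T -> \int[Q]_(w in A) (z k u w - z k 0 w - D u w) =
    a A k u - a A k 0 - \int[mu]_(s in `[0, u]) \sum_l B k l * a A l s.
  move=> /[dup] uT /andP[u0 _]; have [iD <-] := AD u uT.
  rewrite (RintegralB mA (integrable_EFinB mA (iz u u0) (iz 0 (lexx 0))) iD).
  by rewrite (RintegralB mA (iz u u0) (iz 0 (lexx 0))).
have : \int[Q]_(w in A) (z k t w - z k 0 w - D t w) =
    \int[Q]_(w in A) (z k T w - z k 0 w - D T w).
  exact: (dominated_local_martingale filF (Mz k)
    (integrableZl measurableT (2 + T * c) iH) Mbd t0 tT (lexx T) FA).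
rewrite (AM t tT') (AM T TT) => eq1.
rewrite Rintegral_itv_sub//; last first.
  by apply: integrable_lincomb => // l; case: (fub l T TT).
lra.
Qed.

(** [integral_taylor] applied to the i-th coordinates of the B^k a(u). *)
Lemma linear_drift_expmx t T A i : 0 <= t -> t <= T -> F t A ->
  a A i T = \sum_l expmx B (T - t) i l * a A l t.
Proof.
move=> t0 tT FA; have T0 := le_trans t0 tT.
have mA := filtration_measurable filF t0 FA.
have [K [K0 zK]] := linear_drift_bounded T0.
have aK l u : 0 <= u <= T -> `|a A l u| <= K.
  move=> /[dup] uT /andP[u0 _].
  have izA : Q.-integrable A (EFin \o z l u) by exact: linear_drift_integrable.
  have iz : Q.-integrable setT (EFin \o z l u) by exact: linear_drift_integrable.
  apply: le_trans (le_normr_Rintegral mA izA) _.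
  rewrite -lee_fin; apply: le_trans (zK u l uT).
  rewrite /Rintegral fineK; last exact: (integrable_fin_num mA (integrable_norm izA)).
  apply: ge0_subset_integral => //.
  exact: measurable_int (integrable_norm iz).
have ia l : mu.-integrable `[t, T] (fun s => (a A l s)%:E).
  have [] // := @Fubini_process _ _ _ Q (z l) K t T t0 tT (fun u => @mz l u) (@cz l) _ A mA.
  by move=> s /andP[ts sT]; apply: zK; rewrite sT (le_trans t0).
pose f k u := \sum_l (B ^+ k) i l * a A l u.
have cvgf : \sum_(0 <= j < n) ((T - t) ^+ j / j`!%:R * f j t) @[n --> \oo] --> f 0%N T.
  apply: (@integral_taylor _ f (N.+1%:R * K) (entry_bound B)) => //.
  - by rewrite mulr_ge0.
  - exact: entry_bound_ge0.
  - by move=> k; exact: integrable_lincomb.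
  - move=> k u /andP[tu uT]; apply: le_trans (ler_norm_sum _ _ _) _.
    apply: (@le_trans _ _ (\sum_(l < N.+1) K * entry_bound B ^+ k)).
      apply: ler_sum => l _; rewrite normrM mulrC; apply: ler_pM => //.
        by apply: aK; rewrite uT (le_trans t0).
      exact: exprmx_le.
    by rewrite sumr_const card_ord -[leLHS]mulr_natl mulrA.
  - move=> k u /andP[tu uT].
    have iau l : mu.-integrable `[t, u] (fun s => (a A l s)%:E).
      by apply: integrableS (ia l) => //; apply: subset_itvl; rewrite bnd_simp.
    rewrite /f; under eq_bigr => l _ do rewrite (linear_drift_equation l t0 tu FA) mulrDr.
    rewrite big_split/=; congr (_ + _).
    rewrite -Rintegral_lincomb//; last by move=> l; exact: integrable_lincomb.
    apply: eq_Rintegral => v _.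
    under [LHS]eq_bigr do rewrite mulr_sumr.
    rewrite exchange_big/=; apply: eq_bigr => p _.
    by rewrite exprSr mxE mulr_suml; apply: eq_bigr => l _; rewrite mulrA.
have -> : a A i T = f 0%N T.
  rewrite /f expr0 (bigD1 i)//= mxE eqxx mul1r big1 ?addr0// => l li.
  by rewrite mxE eq_sym (negbTE li) mul0r.
rewrite -(cvg_lim _ cvgf)//; apply/cvg_lim => //.
rewrite (_ : (fun n => _) =
    (fun n => \sum_l series (expmx_coeff B (T - t) i l) n * a A l t)).
  by apply: cvg_lincomb => l; rewrite mxE; exact: is_cvg_expmx.
apply/funext => n; rewrite /series/=; under [RHS]eq_bigr do rewrite mulr_suml.
rewrite exchange_big/=; apply: eq_bigr => j _.
by rewrite /f mulr_sumr; apply: eq_bigr => l _; rewrite mulrA.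
Qed.

Lemma linear_drift_cond_exp t T i : 0 <= t -> t <= T ->
  is_cond_exp Q (F t) (z i T) (fun w => \sum_l expmx B (T - t) i l * z l t w).
Proof.
move=> t0 tT; have T0 := le_trans t0 tT.
have iz k u A : 0 <= u -> measurable A -> Q.-integrable A (EFin \o z k u).
  exact: linear_drift_integrable.
split.
- exact: iz.
- by apply: integrable_lincomb => // l; exact: iz.
- apply: measurable_sum => l; apply: measurable_funM => //; exact: az.
- move=> A FA; have mA := filtration_measurable filF t0 FA.
  have iS : Q.-integrable A (EFin \o (fun w => \sum_l expmx B (T - t) i l * z l t w)).
    by apply: integrable_lincomb => // l; exact: iz.
  rewrite -(fineK (integrable_fin_num mA iS)) -(fineK (integrable_fin_num mA (iz i T A T0 mA))).
  congr EFin; rewrite -[RHS]/(a A i T) (linear_drift_expmx i t0 tT FA).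
  by rewrite -[LHS]/(Rintegral Q A _) Rintegral_lincomb// => l; exact: iz.
Qed.

End linear_drift.

(** * Polynomial functions *)

Section polynomial_functions.
Import (canonicals) mpoly.
Context {R : realType} {n : nat}.
Implicit Types (f g h : 'cV[R]_n -> R) (k : nat) (i : 'I_n).

Let mon (m : mpoly.multinom n) (x : 'cV[R]_n) : R := \prod_i x i 0 ^+ mpoly.fun_of_multinom m i.

Let monU i x : mon (mpoly.mnm1 i) x = x i 0.
Proof. by rewrite /mon -(mpoly.mevalX (fun j => x j 0)) mpoly.mevalXU. Qed.

Lemma Pol_seq k f : Pol k f -> exists (s : seq (mpoly.multinom n)) (c : mpoly.multinom n -> R),
  all (fun m => mpoly.mdeg m <= k)%N s /\ f = fun x => \sum_(m <- s) c m * mon m x.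
Proof.
move=> [p [pk ->]]; exists (mpoly.msupp p), (fun m => mpoly.mcoeff m p).
split => //.
Qed.

Lemma Pol_cst k c : Pol k (fun _ : 'cV[R]_n => c).
Proof.
exists (mpoly.mpolyC n c); split.
  by rewrite mpoly.msuppC; case: ifP => //= _; rewrite mpoly.mdeg0.
by apply/funext => x; rewrite /poly_fun mpoly.mevalC.
Qed.

Lemma Pol_coord i : Pol 1 (fun x : 'cV[R]_n => x i 0).
Proof.
exists (mpoly.mpolyX R (mpoly.mnm1 i)); split.
  by rewrite mpoly.msuppX /= mpoly.mdeg1.
by apply/funext => x; rewrite /poly_fun mpoly.mevalXU.
Qed.

Lemma PolM k l f g : Pol k f -> Pol l g -> Pol (k + l) (fun x => f x * g x).
Proof.
move=> [p [pk ->]] [q [ql ->]]; exists (p * q); split.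
  apply/allP => m /mpoly.msuppM_le/allpairsP[[m1 m2] /= [m1p m2q ->]].
  by rewrite mpoly.mdegD leq_add// ?(allP pk)// (allP ql).
by apply/funext => x; rewrite /poly_fun mpoly.mevalM.
Qed.

Lemma PolD k f g : Pol k f -> Pol k g -> Pol k (fun x => f x + g x).
Proof.
move=> [p [pk ->]] [q [qk ->]]; exists (p + q); split.
  apply/allP => m /mpoly.msuppD_le; rewrite mem_cat => /orP[mp|mq].
    exact: (allP pk).
  exact: (allP qk).
by apply/funext => x; rewrite /poly_fun mpoly.mevalD.
Qed.

(** The added 1 makes this function dominate every polynomial function of
    degree at most two, up to a constant. *)
Definition sqnorm1 (x : 'cV[R]_n) : R := 1 + \sum_i x i 0 ^+ 2.

Lemma Pol_sqnorm1 : Pol 2 sqnorm1.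
Proof.
apply: PolD; first exact: Pol_cst.
elim: (index_enum _) => [|i s IH].
  by under eq_fun do rewrite big_nil; exact: Pol_cst.
under eq_fun do rewrite big_cons expr2.
apply: (PolD (f := fun x => x i 0 * x i 0)) => //.
exact: (PolM (Pol_coord i) (Pol_coord i)).
Qed.

Lemma sqr_coord_le i (x : 'cV[R]_n) : x i 0 ^+ 2 <= sqnorm1 x.
Proof.
rewrite /sqnorm1 (bigD1 i)//= addrCA lerDl; apply: addr_ge0 => //.
by apply: sumr_ge0 => j _; exact: sqr_ge0.
Qed.

Lemma sqnorm1_ge1 (x : 'cV[R]_n) : 1 <= sqnorm1 x.
Proof. by rewrite /sqnorm1 lerDl; apply: sumr_ge0 => j _; exact: sqr_ge0. Qed.

Lemma Pol_continuous k f : Pol k f -> continuous f.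
Proof.
move=> /Pol_seq[s [c [_ ->]]].
have cM (T : topologicalType) (u v : T -> R) :
    continuous u -> continuous v -> continuous (fun x => u x * v x).
  by move=> cu cv x; apply: continuousM; [exact: cu|exact: cv].
have cD (T : topologicalType) (u v : T -> R) :
    continuous u -> continuous v -> continuous (fun x => u x + v x).
  by move=> cu cv x; apply: continuousD; [exact: cu|exact: cv].
have cX (T : topologicalType) (u : T -> R) e :
    continuous u -> continuous (fun x => u x ^+ e).
  move=> cu; elim: e => [|e IH].
    by under eq_fun do rewrite expr0; exact: cst_continuous.
  by under eq_fun do rewrite exprS; exact: cM.
have cm m : continuous (mon m).
  rewrite /mon; elim: (index_enum _) => [|i l IH].
    by under eq_fun do rewrite big_nil; exact: cst_continuous.
  under eq_fun do rewrite big_cons.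
  by apply: cM => //; apply: cX; exact: coord_continuous.
elim: s => [|m s IH].
  by under eq_fun do rewrite big_nil; exact: cst_continuous.
under eq_fun do rewrite big_cons.
by apply: cD => //; apply: cM; [exact: cst_continuous|exact: cm].
Qed.

(** With r = sqrt (1 + |x|^2) >= 1, each coordinate is at most r in absolute
    value, so a monomial of degree at most two is at most r^2. *)
Lemma Pol2_bound f : Pol 2 f -> exists C, 0 < C /\ forall x, f x <= C * sqnorm1 x.
Proof.
move=> /Pol_seq[s [c [s2 ->]]].
exists (1 + \sum_(m <- s) `|c m|); split.
  by rewrite ltr_pwDl// sumr_ge0.
move=> x; have q1 := sqnorm1_ge1 x; have q0 := le_trans ler01 q1.
pose r := Num.sqrt (sqnorm1 x).
have r2 : r ^+ 2 = sqnorm1 x by rewrite sqr_sqrtr.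
have r1 : 1 <= r by rewrite -sqrtr1 ler_sqrt.
have r0 : 0 <= r by exact: le_trans r1.
rewrite mulrDl mul1r ler_wpDl// mulr_suml !big_seq ler_sum// => m /(allP s2) m2.
apply: (le_trans (ler_norm _)); rewrite normrM ler_wpM2l//.
have -> : sqnorm1 x = r ^+ 2 by [].
apply: (@le_trans _ _ (r ^+ mpoly.mdeg m)); last exact: ler_weXn2l.
rewrite /mon normr_prod mpoly.mdegE -prodrXr.
apply: ler_prod => i _; rewrite normr_ge0 normrX lerXn2r ?nnegrE ?r0//.
rewrite -(@ler_pXn2r _ 2%N)// ?nnegrE ?r0//.
by rewrite real_normK ?num_real// r2 sqr_coord_le.
Qed.

(** The constant 1 at index 0, followed by the coordinates: a basis of the
    affine functions. *)
Definition affine_basis (l : 'I_n.+1) : 'cV[R]_n -> R :=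
  fun x => oapp (fun i => x i 0) 1 (unlift ord0 l).

Lemma affine_basis0 x : affine_basis ord0 x = 1.
Proof. by rewrite /affine_basis unlift_none. Qed.

Lemma affine_basisS i x : affine_basis (lift ord0 i) x = x i 0.
Proof. by rewrite /affine_basis liftK. Qed.

Lemma Pol_affine_basis l : Pol 1 (affine_basis l).
Proof.
case: (unliftP ord0 l) => [i ->|->].
  rewrite (_ : affine_basis _ = fun x => x i 0); first exact: Pol_coord.
  by apply/funext => x; rewrite affine_basisS.
rewrite (_ : affine_basis _ = fun=> 1); first exact: Pol_cst.
by apply/funext => x; rewrite affine_basis0.
Qed.

Lemma Pol1_affine f : Pol 1 f ->
  exists b : 'I_n.+1 -> R, forall x, f x = \sum_l b l * affine_basis l x.
Proof.
move=> /Pol_seq[s [c [s1 ->]]].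
elim: s s1 => [_|m s IH /= /andP[m1 /IH[b bE]]].
  by exists (fun=> 0) => x; rewrite big_nil big1// => l _; rewrite mul0r.
have [l lE] : exists l, mon m =1 affine_basis l.
  move: m1; rewrite leq_eqVlt => /orP[/mpoly.mdeg1P[i /eqP ->]|].
    by exists (lift ord0 i) => x; rewrite affine_basisS monU.
  rewrite ltnS leqn0 mpoly.mdeg_eq0 => /eqP ->; exists ord0 => x.
  by rewrite affine_basis0 /mon big1// => i _; rewrite mpoly.mnm0E expr0.
exists (fun l' => c m * (l' == l)%:R + b l') => x.
rewrite big_cons bE; under [RHS]eq_bigr do rewrite mulrDl.
rewrite big_split/=; congr (_ + _); rewrite (bigD1 l)//= eqxx mulr1 lE big1 ?addr0// => l' l'l.
by rewrite (negbTE l'l) mulr0 mul0r.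
Qed.

End polynomial_functions.

(** * Polynomial processes *)

Section polynomial_processes.
Context d (Omega : measurableType d) (R : realType) (n : nat).
Variables (Q : probability Omega R) (F : R -> set (set Omega)).
Variable X : R -> Omega -> 'cV[R]_n.
Hypothesis filF : filtration F.

Lemma cadlag_comp (f : 'cV[R]_n -> R) : cadlag X -> continuous f ->
  cadlag (fun t w => f (X t w)).
Proof.
move=> cX cf w; split=> t t0.
  exact: (cvg_comp _ _ ((cX w).1 t t0) (cf _)).
have [l Xl] := (cX w).2 t t0; exists (f l).
exact: (cvg_comp _ _ Xl (cf _)).
Qed.

Lemma adapted_comp (f : 'cV[R]_n -> R) :
  adapted F (X : R -> Omega -> borelV R n) ->
  measurable_fun [set: borelV R n] (f : borelV R n -> R) ->
  adapted F (fun t w => f (X t w)).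
Proof.
move=> aX mf t t0.
exact: (measurableT_comp (mf : measurable_fun setT (f : borelV R n -> R)) (aX t t0)).
Qed.

Hypothesis polX : polynomial_process Q F X.

(** [square_dominated] for N_t = exp(-C t) q(X_t).  The discount is undone at
    the cost of the factor c = exp(C T / 2), because
    (X_s^i / c)^2 = exp(-C T) (X_s^i)^2 <= N_s for s <= T. *)
Lemma polynomial_process_dominated T : 0 <= T ->
  exists H : Omega -> \bar R, Q.-integrable setT H /\
  forall w s i, 0 <= s <= T -> (`|X s w i 0|%:E <= H w)%E.
Proof.
move=> T0.
have [[cX _] [x0 X0] [aX _] [D [G [genG PolD GPol]]]] := polX.
have Dq : D sqnorm1 by apply: PolD; exact: Pol_sqnorm1.
have [C [C0 GC]] := Pol2_bound (GPol 2 _ Pol_sqnorm1).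
have [mq _] := generator_measurable genG Dq.
have q0 (x : 'cV[R]_n) : 0 <= sqnorm1 x by rewrite (le_trans ler01) ?sqnorm1_ge1.
pose Y t w := sqnorm1 (X t w).
have cY : cadlag Y by apply: cadlag_comp => //; exact: Pol_continuous Pol_sqnorm1.
have aY : adapted F Y by exact: adapted_comp.
have super := @exp_supermartingale _ _ _ Q F filF C Y (fun s w => G sqnorm1 (X s w)) C0
  (fun t w _ => q0 _) (fun t t0 => adapted_measurable filF aY t0) cY
  (generator_integrable genG Dq) (fun s w _ => GC _) (generator_martingale genG Dq).
pose N t w := expR (- (C * t)) * Y t w.
have aN : adapted F N.
  by move=> t t0; apply: measurable_funM => //; exact: aY.
have N0 t w : 0 <= t -> 0 <= N t w by move=> _; rewrite mulr_ge0 ?expR_ge0 ?q0.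
have cN : cadlag N by move=> w; exact: cadlag_path_expRN.
have NK : (\int[Q]_w (N 0 w)%:E <= (sqnorm1 x0)%:E)%E.
  under eq_integral do rewrite /N /Y X0 mulr0 oppr0 expR0 mul1r.
  rewrite integral_cst// [X in (_ * X)%E](_ : _ = 1%E) ?mule1//.
  exact: probability_setT.
have [H [iH HN]] := square_dominated filF aN N0 super T cN (q0 x0) NK.
pose c := expR (C * T / 2).
exists (fun w => c%:E * H w)%E; split; first exact: integrableZl.
move=> w s i sT; have /andP[s0 sT'] := sT.
have := HN w s (c^-1 * X s w i 0) sT.
have c0 : 0 < c by exact: expR_gt0.
rewrite normrM (ger0_norm (ltW _)) ?invr_gt0// => le_H.
have -> : `|X s w i 0|%:E = (c%:E * (c^-1 * `|X s w i 0|)%:E)%E.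
  by rewrite -EFinM mulVKf// gt_eqF.
rewrite lee_pmul2l ?lte_fin//; apply: le_H.
rewrite exprMn /N; apply: ler_pM; rewrite ?sqr_ge0//.
  rewrite exprVn /c -expRM_natl -expRN ler_expR lerN2.
  rewrite [leRHS](_ : _ = C * T); last by field.
  by rewrite ler_pM2l.
exact: sqr_coord_le.
Qed.

(** The rows of B are the coordinates of the images of the basis of affine
    functions under the generator, which preserves Pol 1. *)
Lemma polynomial_process_linear_drift : exists B : 'M[R]_n.+1,
  forall k, local_martingale Q F (fun t w =>
    affine_basis k (X t w) - affine_basis k (X 0 w) -
    \int[@lebesgue_measure R]_(s in `[0, t])
       (\sum_l B k l * affine_basis l (X s w))).
Proof.
have [_ _ _ [D [G [genG PolD GPol]]]] := polX.
have Dk k : D (affine_basis k) by apply: PolD; exact: Pol_affine_basis.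
have /choice[b bE] k := Pol1_affine (GPol 1%N _ (Pol_affine_basis k)).
exists (\matrix_(k, l) b k l) => k.
have := generator_martingale genG (Dk k).
congr local_martingale; apply/funext => t; apply/funext => w.
congr (_ - _); apply: eq_Rintegral => s _.
by rewrite bE; apply: eq_bigr => l _; rewrite mxE.
Qed.

Lemma polynomial_process_affine : exists A a,
  affine_with Q F X (fun t T => A (T - t)) (fun t T => a (T - t)).
Proof.
have [[cX _] _ [aX _] [D [G [genG PolD GPol]]]] := polX.
have [B MB] := polynomial_process_linear_drift.
have Dk k : D (affine_basis k) by apply: PolD; exact: Pol_affine_basis.
have cz k : cadlag (fun t w => affine_basis k (X t w)).
  by apply: cadlag_comp => //; exact: Pol_continuous (Pol_affine_basis k).
have az k : adapted F (fun t w => affine_basis k (X t w)).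
  by apply: adapted_comp => //; case: (generator_measurable genG (Dk k)).
have dz T : 0 <= T -> exists H : Omega -> \bar R, Q.-integrable setT H /\
    forall w s k, 0 <= s <= T -> (`|affine_basis k (X s w)|%:E <= H w)%E.
  move=> T0; have [H [iH XH]] := polynomial_process_dominated T0.
  exists (fun w => `|H w| + 1)%E; split.
    apply: integrableD => //; first exact: integrable_abse.
    exact: finite_measure_integrable_cst.
  move=> w s k sT; case: (unliftP ord0 k) => [i ->|->].
    rewrite affine_basisS; apply: le_trans (XH w s i sT) _.
    by apply: le_trans (lee_abs _) _; rewrite leeDl.
  by rewrite affine_basis0 normr1 leeDr.
have zE := linear_drift_cond_exp filF cz az dz MB.
pose A u := \matrix_(i < n, j < n) expmx B u (lift ord0 i) (lift ord0 j).
pose a u := \col_(i < n) expmx B u (lift ord0 i) ord0.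
exists A, a.
have mdiff : measurable_fun [set u : R * R | 0 <= u.1 <= u.2] (fun u => u.2 - u.1).
  by apply: measurable_funTS; exact: measurable_funB.
split.
- move=> i j; rewrite [X in measurable_fun _ X](_ : _ = (fun u : R =>
    expmx B u (lift ord0 i) (lift ord0 j)) \o (fun u : R * R => u.2 - u.1)).
    exact: (measurableT_comp (measurable_expmx _ _ _) mdiff).
  by apply/funext => u; rewrite /= mxE.
- move=> i; rewrite [X in measurable_fun _ X](_ : _ = (fun u : R =>
    expmx B u (lift ord0 i) ord0) \o (fun u : R * R => u.2 - u.1)).
    exact: (measurableT_comp (measurable_expmx _ _ _) mdiff).
  by apply/funext => u; rewrite /= mxE.
- move=> t T t0 tT i; have := zE t T (lift ord0 i) t0 tT.
  congr is_cond_exp; apply/funext => w; first by rewrite affine_basisS.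
  rewrite big_ord_recl affine_basis0 mulr1 !mxE addrC; congr (_ + _).
  by apply: eq_bigr => j _; rewrite [in RHS]mxE affine_basisS.
Qed.

End polynomial_processes.

Theorem proposition12 (d : measure_display) (Omega : measurableType d)
    (R : realType) (P Q : probability Omega R) (F : R -> set (set Omega))
    (n : nat) (X : R -> Omega -> 'cV[R]_n) :
  filtration F -> usual_conditions P F ->
  equivalent_measures P Q ->
  polynomial_process Q F X ->
  [/\ integrable_process Q X,
      affine_process Q F X &
      exists (A : R -> 'M[R]_n) (a : R -> 'cV[R]_n),
        affine_with Q F X (fun t T => A (T - t)) (fun t T => a (T - t))].
Proof.
move=> filF _ _ polX.
have [A [a affX]] := polynomial_process_affine filF polX.
split; last by exists A, a.
- by move=> t t0 i; have [_ _ /(_ t t t0 (lexx t) i)[]] := affX.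
- by exists (fun t T => A (T - t)), (fun t T => a (T - t)).
Qed.
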